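(* For all integers $n\geq 0$, we have $$\sum_{k=-\infty}^\infty (-1)^k(3k+1)B\left(81n+70-54k(3k+2)\right)\equiv 0\pmod{9}.$$
   Context: For $m\in\mathbb{N}$ and $|q|<1$ let $f_m:=\prod_{n\geq 1}(1-q^{mn})$. $B(n)$ denotes the number of partition triples $\pi=(\pi_1,\pi_2,\pi_3)$ of $n$ (the sum of all parts of $\pi_1,\pi_2,\pi_3$ is $n$; empty partitions are allowed) such that $\pi_1$ and $\pi_2$ each consist of distinct odd parts and $\pi_3$ consists of parts divisible by $4$. Equivalently, $\sum_{n=0}^\infty B(n)q^n=\dfrac{f_2^4}{f_1^2f_4^3}$. Convention: $B(m)=0$ for every negative integer $m$, so the sum over $k\in\mathbb{Z}$ has only finitely many nonzero terms. *)

(* Defs.v *)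
From mathcomp Require Import all_boot all_order all_algebra.
From mathcomp Require Import all_classical.
From mathcomp Require Import zify.

Set Implicit Arguments.
Unset Strict Implicit.
Unset Printing Implicit Defensive.

Import GRing.Theory.

(* Partitions are weakly decreasing sequences of positive parts. *)
Definition is_part (s : seq nat) : bool := sorted geq s && all (ltn 0) s.

Definition is_distinct_odd_part (s : seq nat) : bool :=
  [&& is_part s, uniq s & all odd s].

Definition is_mul4_part (s : seq nat) : bool :=
  is_part s && all (dvdn 4) s.

Definition is_part_triple (n : nat) (s1 s2 s3 : seq nat) : bool :=
  [&& is_distinct_odd_part s1, is_distinct_odd_part s2, is_mul4_part s3 &
      sumn s1 + sumn s2 + sumn s3 == n].

(* A partition occurring in a triple of n has at most n parts, each at most n,
   so it is represented by exactly one element of n.-bseq 'I_n.+1 (see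
   bseq_parts_inj and is_part_triple_bseq). *)
Definition bseq_parts (n : nat) (s : n.-bseq 'I_n.+1) : seq nat :=
  [seq nat_of_ord i | i <- s].

Definition B (n : nat) : nat :=
  #|[set t : n.-bseq 'I_n.+1 * n.-bseq 'I_n.+1 * n.-bseq 'I_n.+1 |
      is_part_triple n (bseq_parts t.1.1) (bseq_parts t.1.2)
        (bseq_parts t.2)]|.

Definition Bz (m : int) : nat := if m is Posz n then B n else 0.

Lemma bseq_parts_inj n : injective (@bseq_parts n).
Proof. by move=> s t /(inj_map val_inj) /val_inj. Qed.

Lemma is_part_bseq n (s : seq nat) : is_part s -> sumn s <= n ->
  exists t : n.-bseq 'I_n.+1, bseq_parts t = s.
Proof.
move=> /andP[_ s_gt0] le_sn.
have size_s : size s <= n.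
  apply: leq_trans le_sn; elim: s s_gt0 => //= x s IHs /andP[x_gt0 /IHs].
  by rewrite -add1n; apply: leq_add.
have s_le x : x \in s -> x <= n.
  move=> xs; apply: leq_trans le_sn; elim: s xs {s_gt0 size_s} => //= y s IHs.
  rewrite inE => /predU1P[->|/IHs le_xs]; first exact: leq_addr.
  exact: leq_trans le_xs (leq_addl _ _).
have size_t : size [seq inord x : 'I_n.+1 | x <- s] <= n by rewrite size_map.
exists (Bseq size_t); rewrite /bseq_parts /= -map_comp -[RHS]map_id.
by apply/eq_in_map => x /s_le le_xn /=; rewrite inordK.
Qed.

Lemma is_part_triple_bseq n (s1 s2 s3 : seq nat) : is_part_triple n s1 s2 s3 ->
  exists t : n.-bseq 'I_n.+1 * n.-bseq 'I_n.+1 * n.-bseq 'I_n.+1,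
    [/\ bseq_parts t.1.1 = s1, bseq_parts t.1.2 = s2 & bseq_parts t.2 = s3].
Proof.
case/and4P=> /and3P[p1 _ _] /and3P[p2 _ _] /andP[p3 _] /eqP def_n.
have [|t1 <-] := @is_part_bseq n s1 p1.
  by rewrite -def_n -addnA leq_addr.
have [|t2 <-] := @is_part_bseq n s2 p2.
  by rewrite -def_n addnAC leq_addl.
have [|t3 <-] := @is_part_bseq n s3 p3; first by rewrite -def_n leq_addl.
by exists (t1, t2, t3).
Qed.

(* A sum \sum_(k \in A) F k is 0 by default when F has infinite support in A;
   this lemma excludes that case for terms with a factor B(81n + 70 - 54k(3k + 2))
   and k ranging over all integers. *)
Lemma finite_support_Bz (n : nat) :
  finite_set
    [set k : int | Bz (81 * n%:Z + 70 - 54 * k * (3 * k + 2))%R != 0].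
Proof.
apply: (@sub_finite_set _ _
  [set` [seq (i%:Z - n.+2%:Z)%R | i <- iota 0 (n.+2 + n.+2)]]); last first.
  exact: finite_seq.
move=> k /= Bk.
have [lo hi] : (- n.+2%:Z <= k)%R /\ (k < n.+2%:Z)%R.
  case def_m: (_ - _)%R Bk => [m|//] _.
  have /=: (0 <= m%:Z)%R by [].
  rewrite -def_m; nia.
suff : k \in [seq (i%:Z - n.+2%:Z)%R | i <- iota 0 (n.+2 + n.+2)] by [].
apply/mapP; exists (absz (k + n.+2%:Z)%R); first by rewrite mem_iota; lia.
by lia.
Qed.

(* Main.v *)
Require Import Defs.
From HB Require Import structures.
From mathcomp Require Import all_boot all_order all_algebra.
From mathcomp Require Import all_classical.
From mathcomp Require Import zify ring.

Set Implicit Arguments.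
Unset Strict Implicit.
Unset Printing Implicit Defensive.

Import GRing.Theory.
Local Open Scope ring_scope.

(** Write f for the Euler product (euler), S x = x(q^2), V x = x(q^3). The
    generating function of B is the square of the product of the 1 + q^(2i+1),
    over S (S f). Changing the sign of q, which only affects the theorem by a
    global sign, gives the series F = f^2 / (S f^2 S (S f)) (alt_Bseries_prod).
    It equals ph / y^2, where y = S f^2 / f is the theta series of the triangular
    numbers and ph = S th, where th = f^2 / S f is that of the squares with
    signs. Both product formulas (psi_prod, theta_sq_prod), and Jacobi's formula
    for f^3 (jacobi), are limits of the q-binomial theorem.

    The theorem is about the coefficients of F in the residue class of 16 modulo
    27, that is, about the third series obtained from F by taking successively
    the sections 1, 2, 1 modulo 3. The theta series have simple dissections:
    y = V al + q V (V y) for some al, and ph = V (V ph) - 2 q^2 V G, where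
    G = S gamma and gamma is the sum of (-1)^k q^(3k^2+2k). To get rid of the
    denominator y^2 one uses that cubes are almost series in q^3: x^3 is V x
    modulo 3, and modulo 9 the quotient f^3 / V f is 1 - 3 L, where L modulo 3 is,
    up to sign, a logarithm. Jacobi's formula gives the sections 1 and 2 of L, and its section
    0 is L again (sec0_cube_euler). So y^3 = V y (1 - 3 J) with J = 2 S L - L, and
    F = ph y D / V y with D = 1 + 3 J.

    Three sections can now be taken modulo 9. The sections of J are expressed by
    y, V y and al by comparing the two dissections of y^3 (al_J), and then
    most terms cancel: the second series is ph (V y)^2 D^2 (second_section). In
    its section 1 only multiples of 3 survive, because ph has no section 1: the
    third series is 3 y (V y) al (V ph al + q G V y) (third_section).

    In particular B(27m+16) is divisible by 3, so that the factors 3k + 1 of the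
    theorem can be replaced by 1, and the sum becomes, up to sign, a coefficient
    with index 3n + 2 of the third series times G. Here everything but the factor
    3 matters only modulo 3, where al = f^5 / S f^2 and G = S (S f)^5 / S f^2
    (al_prod, G_prod), and where the dissection of y becomes an algebraic relation
    between f, S f and S (S f) (euler_cubic, quartic_mod3). With these, the
    product is 3 y times a series in q^3 (sec2_third_section). As triangular
    numbers are 0 or 1 modulo 3, its coefficients of index 3n + 2 vanish. *)

(** * Formal power series *)

Record fps (K : Type) := Fps { cf : nat -> K }.

HB.instance Definition _ K := gen_eqMixin (fps K).
HB.instance Definition _ K := gen_choiceMixin (fps K).

Lemma fpsP K (x y : fps K) : (forall n, cf x n = cf y n) <-> x = y.
Proof.
split=> [|-> //]; case: x y => [x] [y] /= xy.
by congr Fps; apply/funext.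
Qed.

Section FpsRing.
Variable K : comNzRingType.
Implicit Types (x y z : fps K) (n N : nat).

Definition trunc N x : {poly K} := \poly_(i < N) cf x i.

Definition fps0 : fps K := Fps (fun _ => 0).
Definition fps1 : fps K := Fps (fun n => (n == 0%N)%:R).
Definition fps_opp x := Fps (fun n => - cf x n).
Definition fps_add x y := Fps (fun n => cf x n + cf y n).
Definition fps_mul x y := Fps (fun n => \sum_(i < n.+1) cf x i * cf y (n - i)).

(** Each coefficient of a product is one of a product of truncations, so that
    the ring axioms follow from those of polynomials. *)
Lemma cf_mul_trunc N n x y : (n < N)%N ->
  cf (fps_mul x y) n = (trunc N x * trunc N y)`_n.
Proof.
move=> nN; rewrite coefM; apply: eq_bigr => i _.
by rewrite !coef_poly (leq_ltn_trans _ nN) ?(leq_ltn_trans _ nN) ?leq_subr // -ltnS.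
Qed.

Lemma coefM_low (p p' r r' : {poly K}) n :
    (forall i, (i <= n)%N -> p`_i = p'`_i) ->
    (forall i, (i <= n)%N -> r`_i = r'`_i) ->
  (p * r)`_n = (p' * r')`_n.
Proof.
move=> pp rr; rewrite !coefM; apply: eq_bigr => i _.
by rewrite pp ?rr ?leq_subr // -ltnS.
Qed.

Lemma fps_addA : associative fps_add.
Proof. by move=> x y z; apply/fpsP => n /=; rewrite addrA. Qed.
Lemma fps_addC : commutative fps_add.
Proof. by move=> x y; apply/fpsP => n /=; rewrite addrC. Qed.
Lemma fps_add0 : left_id fps0 fps_add.
Proof. by move=> x; apply/fpsP => n /=; rewrite add0r. Qed.
Lemma fps_addN : left_inverse fps0 fps_opp fps_add.
Proof. by move=> x; apply/fpsP => n /=; rewrite addNr. Qed.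

HB.instance Definition _ :=
  GRing.isZmodule.Build (fps K) fps_addA fps_addC fps_add0 fps_addN.

Lemma fps_mulC : commutative fps_mul.
Proof.
by move=> x y; apply/fpsP => n; rewrite !(cf_mul_trunc _ _ (ltnSn n)) mulrC.
Qed.

Lemma fps_mulA : associative fps_mul.
Proof.
move=> x y z; apply/fpsP => n; rewrite !(cf_mul_trunc _ _ (ltnSn n)).
have tr u v i : (i <= n)%N ->
    (trunc n.+1 (fps_mul u v))`_i = (trunc n.+1 u * trunc n.+1 v)`_i.
  by move=> le_in; rewrite coef_poly ltnS le_in -cf_mul_trunc.
rewrite (coefM_low (p' := trunc n.+1 x) (r' := trunc n.+1 y * trunc n.+1 z)) //;
  last by move=> i; apply: tr.
rewrite mulrA; apply: coefM_low => // i le_in; by rewrite tr.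
Qed.

Lemma fps_mul1 : left_id fps1 fps_mul.
Proof.
move=> x; apply/fpsP => n /=; rewrite big_ord_recl /= mul1r subn0 big1 ?addr0 //.
by move=> i _; rewrite mul0r.
Qed.

Lemma fps_mulDl : left_distributive fps_mul fps_add.
Proof.
move=> x y z; apply/fpsP => n /=; rewrite -big_split /=.
by apply: eq_bigr => i _; rewrite mulrDl.
Qed.

Lemma fps_1neq0 : fps1 != fps0.
Proof. by apply/eqP => /fpsP /(_ 0%N) /= /eqP; rewrite oner_eq0. Qed.

HB.instance Definition _ := GRing.Zmodule_isComNzRing.Build (fps K)
  fps_mulA fps_mulC fps_mul1 fps_mulDl fps_1neq0.

Lemma cf0 n : cf (0 : fps K) n = 0. Proof. by []. Qed.
Lemma cf1 n : cf (1 : fps K) n = (n == 0%N)%:R. Proof. by []. Qed.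
Lemma cfN x n : cf (- x) n = - cf x n. Proof. by []. Qed.
Lemma cfD x y n : cf (x + y) n = cf x n + cf y n. Proof. by []. Qed.
Lemma cfB x y n : cf (x - y) n = cf x n - cf y n. Proof. by []. Qed.
Lemma cfM x y n :
  cf (x * y) n = \sum_(i < n.+1) cf x i * cf y (n - i).
Proof. by []. Qed.

Lemma cfM0 x y : cf (x * y) 0 = cf x 0 * cf y 0.
Proof. by rewrite cfM big_ord1 subn0. Qed.

Lemma cfX0 x k : cf (x ^+ k) 0 = cf x 0 ^+ k.
Proof.
elim: k => [|k IHk]; first by rewrite !expr0 cf1.
by rewrite !exprS cfM0 IHk.
Qed.

Lemma cf_sum (I : Type) (r : seq I) (P : pred I) (F : I -> fps K) n :
  cf (\sum_(i <- r | P i) F i) n = \sum_(i <- r | P i) cf (F i) n.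
Proof.
by apply: (big_morph (fun x => cf x n)) => // x y; rewrite cfD.
Qed.

Lemma cf_natr m n : cf (m%:R : fps K) n = if n == 0%N then m%:R else 0.
Proof.
elim: m => [|m IHm]; first by rewrite cf0; case: eqP.
by rewrite -addn1 natrD cfD IHm cf1 natrD; case: eqP => _ //; rewrite addr0.
Qed.

Lemma cf_natrM m x n : cf (m%:R * x) n = m%:R * cf x n.
Proof.
rewrite mulr_natl mulr_natl.
by elim: m => [|m IHm]; rewrite ?mulr0n // !mulrS cfD IHm.
Qed.

Definition fX : fps K := Fps (fun n => (n == 1%N)%:R).
Local Notation q := fX.

Lemma cf_Xmul x n : cf (q * x) n = if n is n'.+1 then cf x n' else 0.
Proof.
rewrite cfM; case: n => [|n]; first by rewrite big_ord1 mul0r.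
rewrite big_ord_recl mul0r add0r big_ord_recl /= mul1r big1 ?addr0 ?subn1 //.
by move=> i _; rewrite mul0r.
Qed.

Lemma cf_Xnmul k x n :
  cf (q ^+ k * x) n = if (k <= n)%N then cf x (n - k) else 0.
Proof.
elim: k n => [|k IHk] n; first by rewrite mul1r subn0.
by rewrite exprS -mulrA cf_Xmul; case: n => [|n] //; rewrite IHk ltnS subSS.
Qed.

Lemma cf_Xn k n : cf (q ^+ k) n = (n == k)%:R.
Proof.
rewrite -[q ^+ k]mulr1 cf_Xnmul cf1 subn_eq0.
by case: ltngtP.
Qed.

Lemma fX_lreg k : GRing.lreg (q ^+ k).
Proof.
move=> x y /fpsP xy; apply/fpsP => n; have := xy (k + n)%N.
by rewrite !cf_Xnmul leq_addr addKn.
Qed.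

(** * Congruence modulo powers of the variable *)

Definition eqm N x y := forall n, (n < N)%N -> cf x n = cf y n.

Lemma eqm_sym N x y : eqm N x y -> eqm N y x.
Proof. by move=> xy n /xy. Qed.
Lemma eqm_trans N y x z : eqm N x y -> eqm N y z -> eqm N x z.
Proof. by move=> xy yz n nN; rewrite xy ?yz. Qed.
Lemma eqmP x y : (forall N, eqm N x y) -> x = y.
Proof. by move=> xy; apply/fpsP => n; apply: (xy n.+1). Qed.

Lemma eqmD N x x' y y' : eqm N x x' -> eqm N y y' -> eqm N (x + y) (x' + y').
Proof. by move=> xx yy n nN; rewrite !cfD xx ?yy. Qed.
Lemma eqmN N x x' : eqm N x x' -> eqm N (- x) (- x').
Proof. by move=> xx n nN; rewrite !cfN xx. Qed.
Lemma eqmM N x x' y y' : eqm N x x' -> eqm N y y' -> eqm N (x * y) (x' * y').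
Proof.
move=> xx yy n nN; rewrite !cfM; apply: eq_bigr => i _.
by rewrite xx ?yy // (leq_ltn_trans _ nN) ?leq_subr // -ltnS.
Qed.
Lemma eqmX N x x' k : eqm N x x' -> eqm N (x ^+ k) (x' ^+ k).
Proof.
by move=> xx; elim: k => [|k IHk]; rewrite ?expr0 // !exprS; apply: eqmM.
Qed.
Lemma eqm_sum N (I : Type) (r : seq I) (P : pred I) (F G : I -> fps K) :
    (forall i, P i -> eqm N (F i) (G i)) ->
  eqm N (\sum_(i <- r | P i) F i) (\sum_(i <- r | P i) G i).
Proof.
by move=> FG; elim/big_ind2: _ => // *; apply: eqmD.
Qed.

Lemma eqm_Xn N k x : (N <= k)%N -> eqm N (q ^+ k * x) 0.
Proof.
by move=> Nk n nN; rewrite cf_Xnmul leqNgt (leq_trans nN Nk).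
Qed.

(** The inverse is the geometric series in 1 - x. *)
Lemma fps_unit x : cf x 0 = 1 -> exists x', x * x' = 1.
Proof.
move=> x0; pose u := 1 - x.
have [v def_u] : exists v, u = q * v.
  exists (Fps (fun n => cf u n.+1)); apply/fpsP => n; rewrite cf_Xmul.
  by case: n => //; rewrite cfB cf1 x0 subrr.
have uX N k : (N <= k)%N -> eqm N (u ^+ k) 0.
  by move=> Nk; rewrite def_u exprMn; apply: eqm_Xn.
exists (Fps (fun n => cf (\sum_(i < n.+1) u ^+ i) n)).
apply: eqmP => N.
apply: (@eqm_trans _ (x * \sum_(i < N) u ^+ i)).
  apply: eqmM => // n nN /=; rewrite !cf_sum -(subnKC nN) [RHS]big_split_ord /=.
  rewrite [X in _ + X]big1 ?addr0 // => i _.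
  by rewrite (uX n.+1) ?leq_addr.
have -> : x = 1 - u by rewrite /u opprB addrC subrK.
rewrite -opprB mulNr -subrX1 opprB.
apply: (@eqm_trans _ (1 - 0)); last by rewrite subr0.
by apply: eqmD => //; apply/eqmN/uX.
Qed.

Lemma fps_lreg x : cf x 0 = 1 -> GRing.lreg x.
Proof.
move=> /fps_unit[x' xx'] y z; rewrite /= => /(congr1 ( *%R x')).
by rewrite !mulrA [x' * x]mulrC xx' !mul1r.
Qed.

End FpsRing.

(** * Substitutions, sections and sparse series *)

Section Substitutions.
Variable K : comNzRingType.
Implicit Types (x y z : fps K) (n N k r : nat).
Local Notation q := (fX K).

(** x(q^k), for k > 0. *)
Definition dil k x : fps K := Fps (fun n => if (k %| n)%N then cf x (n %/ k) else 0).

Lemma cf_dil k x n :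
  cf (dil k x) n = if (k %| n)%N then cf x (n %/ k) else 0.
Proof. by []. Qed.

Lemma dilD k x y : dil k (x + y) = dil k x + dil k y.
Proof. by apply/fpsP => n; rewrite cfD /=; case: ifP; rewrite ?addr0. Qed.
Lemma dilN k x : dil k (- x) = - dil k x.
Proof. by apply/fpsP => n; rewrite cfN /=; case: ifP; rewrite ?oppr0. Qed.
Lemma dilB k x y : dil k (x - y) = dil k x - dil k y.
Proof. by rewrite dilD dilN. Qed.
Lemma dil0 k : dil k 0 = 0.
Proof. by apply/fpsP => n /=; rewrite if_same. Qed.

Lemma dilM k x y : (0 < k)%N -> dil k (x * y) = dil k x * dil k y.
Proof.
move=> k0; apply/fpsP => n /=.
have -> : \sum_(i < n.+1) cf (dil k x) i * cf (dil k y) (n - i)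
    = (trunc n.+1 (dil k x) * trunc n.+1 (dil k y))`_n.
  by rewrite -cf_mul_trunc.
have low z i : (i <= n)%N ->
    (trunc n.+1 (dil k z))`_i = (trunc n.+1 z \Po 'X^k)`_i.
  move=> lei; rewrite coef_poly ltnS lei coef_comp_poly_Xn // coef_poly /=.
  by case: ifP => // _; rewrite ltnS (leq_trans (leq_div _ _) lei).
rewrite (coefM_low (low x) (low y)) -rmorphM /= coef_comp_poly_Xn //.
by case: ifP => // _; rewrite -cf_mul_trunc // ltnS leq_div.
Qed.

Lemma dil1 k : (0 < k)%N -> dil k 1 = 1.
Proof.
move=> k0; apply/fpsP => n; rewrite /dil [LHS]/= !cf1.
case: (posnP n) => [->|n0]; first by rewrite dvdn0 div0n.
case: ifP => // kn; by rewrite gtn_eqF // divn_gt0 // dvdn_leq.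
Qed.

Lemma dilX k x n : (0 < k)%N -> dil k (x ^+ n) = dil k x ^+ n.
Proof.
by move=> k0; elim: n => [|n IHn]; rewrite ?expr0 ?dil1 // !exprS dilM // IHn.
Qed.

Lemma dil_natr k m : (0 < k)%N -> dil k m%:R = m%:R.
Proof.
by move=> k0; elim: m => [|m IHm]; rewrite ?dil0 // -addn1 !natrD dilD IHm dil1.
Qed.

Lemma dil_fX k : (0 < k)%N -> dil k q = q ^+ k.
Proof.
move=> k0; apply/fpsP => n; rewrite cf_Xn /=; case: ifP => [/dvdnP[m ->]|].
  by rewrite mulnK // -{2}[k]mul1n eqn_pmul2r.
by case: eqP => // ->; rewrite dvdnn.
Qed.

Lemma dil_dil j k x : (0 < j)%N -> (0 < k)%N -> dil j (dil k x) = dil (j * k) x.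
Proof.
move=> j0 k0; apply/fpsP => n /=; rewrite mulnC.
case: (boolP (j %| n)%N) => [/dvdnP[m ->]|jn]; last first.
  by case: ifP => // /(dvdn_trans (dvdn_mull k (dvdnn j))); rewrite (negPf jn).
by rewrite dvdn_pmul2r // mulnK // divnMr.
Qed.

Lemma eqm_dil k N x y : (0 < k)%N -> eqm N x y -> eqm N (dil k x) (dil k y).
Proof.
move=> k0 xy n nN /=; case: ifP => // _; apply: xy.
exact: leq_ltn_trans (leq_div _ _) nN.
Qed.

Lemma cf_dil0 k x : cf (dil k x) 0 = cf x 0.
Proof. by rewrite /= dvdn0 div0n. Qed.

(** x(-q). *)
Definition alt x : fps K := Fps (fun n => (-1) ^+ n * cf x n).

Lemma altD x y : alt (x + y) = alt x + alt y.
Proof. by apply/fpsP => n /=; rewrite mulrDr. Qed.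

Lemma altM x y : alt (x * y) = alt x * alt y.
Proof.
apply/fpsP => n /=; rewrite mulr_sumr; apply: eq_bigr => i _.
rewrite -[in (-1) ^+ n](subnKC (ltnSE (ltn_ord i))) exprD; ring.
Qed.

Lemma alt1 : alt 1 = 1.
Proof. by apply/fpsP => -[|n] /=; rewrite ?mulr0 ?mulr1. Qed.

Lemma altX x n : alt (x ^+ n) = alt x ^+ n.
Proof. by elim: n => [|n IHn]; rewrite ?expr0 ?alt1 // !exprS altM IHn. Qed.

Lemma alt_fX : alt q = - q.
Proof. by apply/fpsP => -[|[|n]] /=; rewrite ?mulr0 ?mulr1 ?oppr0. Qed.

Lemma eqm_alt N x y : eqm N x y -> eqm N (alt x) (alt y).
Proof. by move=> xy n nN /=; rewrite xy. Qed.

(** The sections of x: x(q) is the sum of q^r (sec r x)(q^3) for r = 0, 1, 2. *)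
Definition sec r x : fps K := Fps (fun n => cf x (3 * n + r)).

Local Notation V := (dil 3).

Lemma cf_sec r x n : cf (sec r x) n = cf x (3 * n + r). Proof. by []. Qed.
Lemma secD r x y : sec r (x + y) = sec r x + sec r y. Proof. by []. Qed.
Lemma secN r x : sec r (- x) = - sec r x. Proof. by []. Qed.
Lemma secB r x y : sec r (x - y) = sec r x - sec r y. Proof. by []. Qed.
Lemma sec_natrM r m x : sec r (m%:R * x) = m%:R * sec r x.
Proof. by apply/fpsP => n; rewrite cf_natrM; apply: cf_natrM. Qed.

Lemma cfV x m :
  [/\ cf (V x) (3 * m) = cf x m, cf (V x) (3 * m).+1 = 0 & cf (V x) (3 * m).+2 = 0].
Proof.
rewrite /= dvdn_mulr // mulKn //.
by split=> //; case: ifP => // /dvdnP[j]; lia.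
Qed.

Lemma secV x : [/\ sec 0 (V x) = x, sec 1 (V x) = 0 & sec 2 (V x) = 0].
Proof.
split; apply/fpsP => n; have [H0 H1 H2] := cfV x n; rewrite /sec [LHS]/=.
- by rewrite -H0 addn0.
- by rewrite -[RHS]H1 addn1.
- by rewrite -[RHS]H2 addn2.
Qed.

(** Doubling exchanges the residues 1 and 2 modulo 3; the factor q in the middle
    comes from 2 * 2 = 3 + 1. *)
Lemma sec_dil2 x :
  [/\ sec 0 (dil 2 x) = dil 2 (sec 0 x), sec 1 (dil 2 x) = q * dil 2 (sec 2 x) &
      sec 2 (dil 2 x) = dil 2 (sec 1 x)].
Proof.
split; apply/fpsP => n; rewrite ?cf_Xmul.
- rewrite /= addn0 Gauss_dvdr //; case: ifP => // /dvdnP[m ->].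
  by rewrite mulnA !mulnK // addn0.
- case: n => [|n] //=; rewrite mulnS addnC addnA dvdn_addr // Gauss_dvdr //.
  by case: ifP => // /dvdnP[m ->]; congr (cf x _); lia.
- rewrite /= dvdn_addl // Gauss_dvdr //; case: ifP => // /dvdnP[m ->].
  by congr (cf x _); lia.
Qed.

Lemma cf_dissection a b c n (x := V a + q * V b + q ^+ 2 * V c) :
  [/\ cf x (3 * n) = cf a n, cf x (3 * n).+1 = cf b n & cf x (3 * n).+2 = cf c n].
Proof.
rewrite /x !cfD !cf_Xmul !cf_Xnmul.
have [Va0 Va1 Va2] := cfV a n; have [Vb0 Vb1 Vb2] := cfV b n.
have [Vc0 Vc1 Vc2] := cfV c n.
rewrite Va0 Va1 Va2 !subSS subn0 !ltnS leq0n Vb0 Vb1 Vc0 !add0r.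
split=> //.
- case: n {Va0 Va1 Va2 Vb0 Vb1 Vb2 Vc0 Vc1 Vc2} => [|n]; first by rewrite !addr0.
  have [_ _ vb2] := cfV b n; have [_ vc1 _] := cfV c n.
  move: (V b) (V c) vb2 vc1 => vb vc vb2 vc1.
  by rewrite mulnS !addSn add0n subn2 /= vb2 vc1 !addr0.
- case: n {Va0 Va1 Va2 Vb0 Vb1 Vb2 Vc0 Vc1 Vc2} => [|n]; first by rewrite !addr0.
  have [_ _ vc2] := cfV c n; move: (V c) vc2 => vc vc2.
  by rewrite mulnS !addSn add0n subn1 /= vc2 addr0.
Qed.

Lemma sec_dissection a b c :
  [/\ sec 0 (V a + q * V b + q ^+ 2 * V c) = a,
      sec 1 (V a + q * V b + q ^+ 2 * V c) = b &
      sec 2 (V a + q * V b + q ^+ 2 * V c) = c].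
Proof.
split; apply/fpsP => n; have [H0 H1 H2] := cf_dissection a b c n.
- by rewrite -[RHS]H0 /sec [LHS]/= addn0.
- by rewrite -[RHS]H1 /sec [LHS]/= addn1.
- by rewrite -[RHS]H2 /sec [LHS]/= addn2.
Qed.

Lemma dissection x : x = V (sec 0 x) + q * V (sec 1 x) + q ^+ 2 * V (sec 2 x).
Proof.
apply/fpsP => n; rewrite (divn_eq n 3) mulnC; move: (n %/ 3)%N => m.
have [H0 H1 H2] := cf_dissection (sec 0 x) (sec 1 x) (sec 2 x) m.
case: (n %% 3)%N (ltn_pmod n (isT : 0 < 3)%N) => [|[|[|//]]] _.
- by rewrite [in RHS]addn0 H0.
- by rewrite [in RHS]addn1 H1.
- by rewrite [in RHS]addn2 H2.
Qed.

Lemma secM x y :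
  [/\ sec 0 (x * y) = sec 0 x * sec 0 y + q * (sec 1 x * sec 2 y + sec 2 x * sec 1 y),
      sec 1 (x * y) = sec 0 x * sec 1 y + sec 1 x * sec 0 y + q * (sec 2 x * sec 2 y) &
      sec 2 (x * y) = sec 0 x * sec 2 y + sec 1 x * sec 1 y + sec 2 x * sec 0 y].
Proof.
have [] := sec_dissection (sec 0 x * sec 0 y + q * (sec 1 x * sec 2 y + sec 2 x * sec 1 y))
  (sec 0 x * sec 1 y + sec 1 x * sec 0 y + q * (sec 2 x * sec 2 y))
  (sec 0 x * sec 2 y + sec 1 x * sec 1 y + sec 2 x * sec 0 y).
suff -> : x * y = V (sec 0 x * sec 0 y + q * (sec 1 x * sec 2 y + sec 2 x * sec 1 y))
    + q * V (sec 0 x * sec 1 y + sec 1 x * sec 0 y + q * (sec 2 x * sec 2 y))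
    + q ^+ 2 * V (sec 0 x * sec 2 y + sec 1 x * sec 1 y + sec 2 x * sec 0 y) by [].
rewrite {1}(dissection x) {1}(dissection y).
move: (sec 0 x) (sec 1 x) (sec 2 x) (sec 0 y) (sec 1 y) (sec 2 y) => a b c a' b' c'.
by rewrite !(dilD, dilM) // dil_fX //; ring.
Qed.
Definition sec0M x y := let: And3 h _ _ := secM x y in h.
Definition sec1M x y := let: And3 _ h _ := secM x y in h.
Definition sec2M x y := let: And3 _ _ h := secM x y in h.

Lemma sec_dilM r u x : (r < 3)%N -> sec r (V u * x) = u * sec r x.
Proof.
have [V0 V1 V2] := secV u.
by case: r => [|[|[|//]]] _; rewrite (sec0M, sec1M, sec2M) V0 V1 V2; ring.
Qed.

(** The sum of c m q^(e m) over m; stopping at m = n is harmless when m <= e m. *)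
Definition sparse (e : nat -> nat) (c : nat -> K) : fps K :=
  Fps (fun n => \sum_(m < n.+1) c m *+ (e m == n)).

Lemma cf_sparse e c M n : (forall m, (m <= e m)%N) -> (n < M)%N ->
  cf (sparse e c) n = \sum_(m < M) c m *+ (e m == n).
Proof.
move=> le_e nM; rewrite /= -(subnKC nM) [RHS]big_split_ord /=.
rewrite [X in _ + X]big1 ?addr0 // => i _.
by have := le_e (n.+1 + i)%N; case: eqP => // ->; lia.
Qed.

Lemma sparse_eqm e c (g : nat -> fps K) N M :
    (forall m, (m <= e m)%N) -> (forall m n, cf (g m) n = c m *+ (e m == n)) ->
    (N <= M)%N ->
  eqm N (sparse e c) (\sum_(m < M) g m).
Proof.
move=> le_e gE NM n nN; rewrite (cf_sparse _ (M := M)) // ?(leq_trans nN) //.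
by rewrite cf_sum; apply: eq_bigr.
Qed.

Lemma sum_mod3 (F : nat -> K) M :
  \sum_(m < 3 * M) F m = \sum_(j < M) (F (3 * j)%N + F (3 * j + 1)%N + F (3 * j + 2)%N).
Proof.
elim: M => [|M IHM]; first by rewrite muln0 !big_ord0.
rewrite mulnS addnC addn3 !big_ord_recr /= IHM -!addrA; congr (_ + _).
by rewrite addn1 addn2.
Qed.

(** When factor i is 1 modulo q^(i+1), the n-th coefficient of the partial
    products no longer changes after the first n factors. *)
Definition iprod (g : nat -> fps K) : fps K := Fps (fun n => cf (\prod_(i < n) g i) n).

Lemma iprod_eqm g N M : (forall i, eqm i.+1 (g i) 1) -> (N <= M)%N ->
  eqm N (iprod g) (\prod_(i < M) g i).
Proof.
move=> g1 NM n nN; rewrite {1}/iprod /=.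
have {nN NM} : (n <= M)%N by lia.
elim: M => [|M IHM]; first by rewrite leqn0 => /eqP->.
rewrite leq_eqVlt => /predU1P[->//|]; rewrite ltnS => nM.
rewrite big_ord_recr /= IHM //.
have : eqm M.+1 (\prod_(i < M) g i * 1) (\prod_(i < M) g i * g M).
  by apply: eqmM => //; apply: eqm_sym.
by rewrite mulr1; apply; rewrite ltnS.
Qed.

Lemma eqm1B N k : (N <= k)%N -> eqm N (1 - q ^+ k) 1.
Proof.
move=> Nk; rewrite -[X in eqm _ _ X]subr0; apply: eqmD => //; apply: eqmN.
by rewrite -[q ^+ k]mulr1; apply: eqm_Xn.
Qed.

Lemma eqm1D N k : (N <= k)%N -> eqm N (1 + q ^+ k) 1.
Proof.
move=> Nk; rewrite -[X in eqm _ _ X]addr0; apply: eqmD => //.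
by rewrite -[q ^+ k]mulr1; apply: eqm_Xn.
Qed.

End Substitutions.

(** * Gaussian binomials *)

Section Gauss.
Variable R : comNzRingType.
Implicit Types (x y z : R) (m n j : nat).

Definition qpoch x m : R := \prod_(i < m) (1 - x ^+ i.+1).

Fixpoint gbin x m j : R :=
  match m, j with
  | _, 0%N => 1
  | 0%N, _.+1 => 0
  | m'.+1, j'.+1 => gbin x m' j' + x ^+ j * gbin x m' j
  end.

Lemma gbin0 x m : gbin x m 0 = 1. Proof. by case: m. Qed.

Lemma gbin_small x m j : (m < j)%N -> gbin x m j = 0.
Proof.
elim: m j => [|m IHm] [|j] //= lt_mj.
by rewrite !IHm ?mulr0 ?addr0 // ltnW.
Qed.

Lemma qpoch0 x : qpoch x 0 = 1. Proof. exact: big_ord0. Qed.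
Lemma qpochS x m : qpoch x m.+1 = qpoch x m * (1 - x ^+ m.+1).
Proof. exact: big_ord_recr. Qed.

(** The product formula for Gaussian binomials, without division. *)
Lemma gbin_qpoch x m j : (j <= m)%N ->
  gbin x m j * qpoch x j * qpoch x (m - j) = qpoch x m.
Proof.
elim: m j => [|m IHm] [|j] //=; rewrite ?subn0 ?qpoch0 ?mulr1 ?mul1r // ltnS => le_jm.
rewrite subSS; have := IHm _ le_jm.
move: le_jm; rewrite leq_eqVlt => /predU1P[->|lt_jm] E.
  by rewrite (gbin_small x (ltnSn m)) mulr0 addr0 qpochS mulrA mulrAC E.
have := IHm _ lt_jm; rewrite -[(m - j)%N]prednK ?subn_gt0 // -subnS in E * => E'.
rewrite !mulrDl; transitivity ((1 - x ^+ j.+1) * qpoch x m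
    + x ^+ j.+1 * (1 - x ^+ (m - j.+1).+1) * qpoch x m).
  by rewrite -{1}E -E' !qpochS; ring.
rewrite qpochS.
have -> : x ^+ m.+1 = x ^+ j.+1 * x ^+ (m - j.+1).+1.
  by rewrite -exprD; congr (x ^+ _); lia.
ring.
Qed.

(** The q-binomial theorem; the induction splits off the factor with i = 0, which
    replaces z by z x and matches the Pascal rule defining gbin. *)
Lemma gbin_thm x y z m :
  \prod_(i < m) (y + z * x ^+ i) =
  \sum_(j < m.+1) gbin x m j * x ^+ 'C(j, 2) * z ^+ j * y ^+ (m - j).
Proof.
elim: m z => [|m IHm] z; first by rewrite big_ord0 big_ord1 /= !mulr1.
rewrite big_ord_recl expr0 mulr1.
have -> : \prod_(i < m) (y + z * x ^+ lift ord0 i) = \prod_(i < m) (y + z * x * x ^+ i).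
  by apply: eq_bigr => i _; rewrite /bump /= exprS mulrA.
rewrite IHm mulrDl.
have -> : \sum_(j < m.+2) gbin x m.+1 j * x ^+ 'C(j, 2) * z ^+ j * y ^+ (m.+1 - j) =
   y ^+ m.+1 + \sum_(j < m.+1) (gbin x m j * x ^+ 'C(j.+1, 2) * z ^+ j.+1 * y ^+ (m - j) +
     x ^+ j.+1 * gbin x m j.+1 * x ^+ 'C(j.+1, 2) * z ^+ j.+1 * y ^+ (m - j)).
  rewrite big_ord_recl /= !mul1r subn0; congr (_ + _); apply: eq_bigr => j _.
  by rewrite /bump /= subSS; ring.
rewrite big_split [in RHS]addrCA addrC /=.
congr (_ + _); last first.
  rewrite mulr_sumr; apply: eq_bigr => j _.
  by rewrite binS bin1 exprD exprMn exprS; ring.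
rewrite big_ord_recl /= gbin0 !mul1r subn0 [in RHS]big_ord_recr /= gbin_small //.
rewrite mulr0 !mul0r addr0 mulrDr -exprS mulr_sumr; congr (_ + _).
apply: eq_bigr => j _; rewrite /bump /= add1n exprMn.
have -> : (m - j = (m - j.+1).+1)%N by have := ltn_ord j; lia.
rewrite [y ^+ (m - j.+1).+1]exprS; move: (y ^+ (m - j.+1)) (x ^+ 'C(j.+1, 2)) => Y X; ring.
Qed.

End Gauss.

(** * Theta series as infinite products *)

Definition tri m := 'C(m.+1, 2).

Lemma tri_dbl m : (2 * tri m = m * m.+1)%N.
Proof. by rewrite /tri -mul_bin_diag bin1 mulnC. Qed.

Lemma bin2_dbl m : (2 * 'C(m, 2) + m = m * m)%N.
Proof. by case: m => [|m] //; rewrite tri_dbl; lia. Qed.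

Lemma leq_tri m : (m <= tri m)%N.
Proof. by rewrite -(leq_pmul2l (isT : 0 < 2)%N) tri_dbl; nia. Qed.

Lemma sum_center (U : nmodType) n (F : nat -> U) :
  \sum_(j < (n + n).+2) F j = \sum_(m < n.+1) (F (n - m)%N + F (n.+1 + m)%N).
Proof.
rewrite -addSn -addnS big_split_ord /= big_split /=; congr (_ + _).
by rewrite (reindex_inj rev_ord_inj); apply: eq_bigr => i _; rewrite /= subSS.
Qed.

(** The q-binomial theorem with an odd number of factors, at y = x^n, is a finite
    form of the triple product identity: about the centre of the sum the
    exponents are a constant plus the triangular numbers, each taken twice. *)
Lemma gbin_thm_odd (R : comNzRingType) (x z : R) n :
  x ^+ n * (1 + z) * (\prod_(i < n) (x ^+ n + z * x ^+ i)) *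
     (\prod_(i < n) (x ^+ n + z * x ^+ (n.+1 + i))) =
  x ^+ ('C(n, 2) + n * n + n) * \sum_(m < n.+1) x ^+ tri m *
    (gbin x (n + n).+1 (n - m) * z ^+ (n - m)
      + gbin x (n + n).+1 (n.+1 + m) * z ^+ (n.+1 + m)).
Proof.
transitivity (\prod_(i < n.+1 + n) (x ^+ n + z * x ^+ i)).
  by rewrite big_split_ord /= big_ord_recr /=; ring.
rewrite addSn gbin_thm (sum_center n
  (fun j => gbin x (n + n).+1 j * x ^+ 'C(j, 2) * z ^+ j * (x ^+ n) ^+ ((n + n).+1 - j))) mulr_sumr; apply: eq_bigr => m _.
move: (nat_of_ord m) (ltn_ord m) => {}m lt_mn.
have E1 : ('C(n - m, 2) + n * ((n + n).+1 - (n - m)) = 'C(n, 2) + n * n + n + tri m)%N.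
  have -> : (n = (n - m) + m)%N by lia.
  move: (n - m)%N => j; rewrite addnK.
  have -> : ((j + m + (j + m)).+1 - j = j + m + m.+1)%N by lia.
  have := bin2_dbl j; have := bin2_dbl (j + m); have := tri_dbl m; lia.
have E2 : ('C(n.+1 + m, 2) + n * ((n + n).+1 - (n.+1 + m)) = 'C(n, 2) + n * n + n + tri m)%N.
  have -> : (n = (n - m) + m)%N by lia.
  move: (n - m)%N => j.
  have -> : ((j + m + (j + m)).+1 - ((j + m).+1 + m) = j)%N by lia.
  have := bin2_dbl ((j + m).+1 + m); have := bin2_dbl (j + m); have := tri_dbl m; lia.
rewrite -!exprM mulrDr mulrDr.
congr (_ + _).
- transitivity (gbin x (n + n).+1 (n - m) * z ^+ (n - m) * x ^+ ('C(n - m, 2) + n * ((n + n).+1 - (n - m)))).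
    by rewrite [x ^+ (_ + _)]exprD mulrA [X in _ = X * _]mulrAC.
  by rewrite E1 [x ^+ (_ + tri m)]exprD mulrC mulrA.
- transitivity (gbin x (n + n).+1 (n.+1 + m) * z ^+ (n.+1 + m) * x ^+ ('C(n.+1 + m, 2) + n * ((n + n).+1 - (n.+1 + m)))).
    by rewrite [x ^+ (_ + _)]exprD mulrA [X in _ = X * _]mulrAC.
  by rewrite E2 [x ^+ (_ + tri m)]exprD mulrC mulrA.
Qed.

Section Theta.
Variable K : comNzRingType.
Local Notation q := (fX K).

Definition euler : fps K := iprod (fun i => 1 - q ^+ i.+1).

Lemma dil_prod k n (F : nat -> fps K) : (0 < k)%N ->
  dil k (\prod_(i < n) F i) = \prod_(i < n) dil k (F i).
Proof.
by move=> k0; elim: n => [|n IHn]; rewrite ?big_ord0 ?dil1 // !big_ord_recr /= dilM // IHn.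
Qed.

Lemma euler_eqm k N M : (0 < k)%N -> (N <= M)%N ->
  eqm N (dil k euler) (qpoch (q ^+ k) M).
Proof.
move=> k0 NM; apply: (@eqm_trans _ _ (dil k (qpoch q M))).
  by apply: eqm_dil => //; apply: iprod_eqm => // i; apply: eqm1B.
rewrite /qpoch (dil_prod _ (fun i => 1 - q ^+ i.+1)) //.
suff -> : \prod_(i < M) dil k (1 - q ^+ i.+1) = \prod_(i < M) (1 - (q ^+ k) ^+ i.+1) by [].
by apply: eq_bigr => i _; rewrite dilB dil1 // dilX // dil_fX.
Qed.

Lemma dil_id (x : fps K) : dil 1 x = x.
Proof. by apply/fpsP => n /=; rewrite dvd1n divn1. Qed.

Lemma cf_euler0 : cf euler 0 = 1.
Proof. by rewrite /= big_ord0. Qed.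

Lemma eqm_cancel N (u x y : fps K) : cf u 0 = 1 -> eqm N (u * x) (u * y) -> eqm N x y.
Proof.
move=> /fps_unit[v uv] xy.
have : eqm N (v * (u * x)) (v * (u * y)) by apply: eqmM.
by rewrite !mulrA [v * u]mulrC uv !mul1r.
Qed.

(** Central Gaussian binomials tend to the inverse of the Euler product, because
    the three products in gbin_qpoch tend to the Euler product. *)
Lemma gbin_eqm k N m j : (0 < k)%N -> (N <= j)%N -> (N + j <= m)%N ->
  eqm N (dil k euler * gbin (q ^+ k) m j) 1.
Proof.
move=> k0 Nj jm; have lim M := @euler_eqm k N M k0.
apply: (@eqm_cancel _ (dil k euler)); first by rewrite cf_dil0 cf_euler0.
rewrite mulr1.
apply: (@eqm_trans _ _ (gbin (q ^+ k) m j * qpoch (q ^+ k) j * qpoch (q ^+ k) (m - j))).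
  rewrite mulrA mulrC mulrA; apply: eqmM; first apply: eqmM => //; by apply: lim; lia.
rewrite gbin_qpoch; last by lia.
by apply: eqm_sym; apply: lim; lia.
Qed.

Lemma eqm_XnM N k (x y : fps K) :
  ((k < N)%N -> eqm N x y) -> eqm N (q ^+ k * x) (q ^+ k * y).
Proof.
move=> xy; case: (ltnP k N) => [/xy {}xy|Nk]; first exact: eqmM.
by apply: (@eqm_trans _ _ 0); [|apply: eqm_sym]; apply: eqm_Xn.
Qed.

Lemma cf_signXn (m k n : nat) : cf ((-1) ^+ m * q ^+ k : fps K) n = (-1) ^+ m *+ (k == n).
Proof.
elim: m => [|m IHm]; first by rewrite mul1r cf_Xn eq_sym.
by rewrite exprS -mulrA mulN1r cfN IHm exprS mulN1r mulNrn.
Qed.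

Lemma prod_lead n : \prod_(i < n) q ^+ i = q ^+ 'C(n, 2) :> fps K.
Proof.
elim: n => [|n IHn]; first by rewrite big_ord0.
by rewrite big_ord_recr /= IHn -exprD binS bin1.
Qed.

(** Taking out the lowest power of q from each factor leaves the products that
    tend to the infinite products of the triple product identity. *)
Lemma halves_odd (s : fps K) n :
  (\prod_(i < n) (q ^+ n + s * q ^+ i)) * (\prod_(i < n) (q ^+ n + s * q ^+ (n.+1 + i)))
  = q ^+ ('C(n, 2) + n * n) * (\prod_(i < n) (s + q ^+ i.+1)) * \prod_(i < n) (1 + s * q ^+ i.+1).
Proof.
have -> : \prod_(i < n) (q ^+ n + s * q ^+ i) = q ^+ 'C(n, 2) * \prod_(i < n) (s + q ^+ i.+1).
  rewrite -prod_lead [X in _ = _ * X](reindex_inj rev_ord_inj) -big_split.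
  apply: eq_bigr => i _ /=; rewrite mulrDr mulrC addrC -exprD.
  by congr (_ + q ^+ _); have := ltn_ord i; lia.
have -> : \prod_(i < n) (q ^+ n + s * q ^+ (n.+1 + i))
    = q ^+ (n * n) * \prod_(i < n) (1 + s * q ^+ i.+1).
  have -> : q ^+ (n * n) = \prod_(i < n) q ^+ n by rewrite prodr_const card_ord exprM.
  rewrite -big_split; apply: eq_bigr => i _ /=.
  by rewrite addSnnS exprD; ring.
by rewrite exprD; ring.
Qed.

(** ** Jacobi's identity for the cube of the Euler product *)

Lemma gbin_polyC (R : comNzRingType) (x : R) m j : gbin x%:P m j = (gbin x m j)%:P.
Proof.
elim: m j => [|m IHm] [|j] /=; rewrite ?polyC0 ?polyC1 //.
by rewrite !IHm polyCD polyCM polyC_exp.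
Qed.

Lemma signs_cancel (R : comNzRingType) (m n : nat) : (m <= n)%N ->
  (-1) ^+ n * (-1) ^+ (n - m) = (-1) ^+ m :> R.
Proof.
move=> le_mn; rewrite -{1}(subnK le_mn) addnC exprD -mulrA -exprD addnn.
by rewrite -mul2n exprM sqrrN expr1n expr1n mulr1.
Qed.

(** The finite triple product has a factor 1 + z, which vanishes at z = -1: the
    identity below is its derivative there. It is taken with polynomials in the
    indeterminate -z, evaluated at 1. *)
Lemma jacobi_finite n :
  qpoch q n * qpoch q n = \sum_(m < n.+1) q ^+ tri m * ((-1) ^+ m *
    ((n.+1 + m)%:R * gbin q (n + n).+1 (n.+1 + m) - (n - m)%:R * gbin q (n + n).+1 (n - m))).
Proof.
pose D (p : {poly fps K}) := p^`().[1].
have DM c p : D (c%:P * p) = c * D p by rewrite /D derivM derivC mul0r add0r hornerM hornerC.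
have DD p r : D (p + r) = D p + D r by rewrite /D derivD hornerD.
have DX k : D ((- 'X) ^+ k) = (-1) ^+ k * k%:R.
  have -> : (- 'X) ^+ k = ((-1) ^+ k)%:P * 'X^k :> {poly fps K}.
    by rewrite polyC_exp polyCN [LHS]exprNn.
  by rewrite DM /D derivXn hornerMn hornerXn expr1n.
have D0 : D 0 = 0 by rewrite /D deriv0 horner0.
pose c : {poly fps K} := (\prod_(i < n) (q%:P ^+ n + - 'X * q%:P ^+ i)) *
     (\prod_(i < n) (q%:P ^+ n + - 'X * q%:P ^+ (n.+1 + i))).
have c1 : c.[1] = q ^+ ('C(n, 2) + n * n) * ((-1) ^+ n * (qpoch q n * qpoch q n)).
  transitivity ((\prod_(i < n) (q ^+ n + -1 * q ^+ i)) *
                (\prod_(i < n) (q ^+ n + -1 * q ^+ (n.+1 + i)))).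
    rewrite hornerM !horner_prod; congr (_ * _); apply: eq_bigr => i _;
    by rewrite -!polyC_exp !hornerE.
  rewrite halves_odd -mulrA; congr (_ * _); rewrite mulrA; congr (_ * _); last first.
    by apply: eq_bigr => i _; rewrite mulN1r.
  have -> : (-1) ^+ n = \prod_(i < n) -1 :> fps K by rewrite prodr_const card_ord.
  by rewrite -big_split; apply: eq_bigr => i _; rewrite /= mulN1r opprB addrC.
have Dc r : D ((1 + - 'X) * r) = - r.[1].
  rewrite /D derivM derivB derivX derivC sub0r hornerD !hornerM hornerN hornerD.
  by rewrite hornerN hornerX hornerC subrr mul0r addr0 mulN1r.
have /(congr1 D) := gbin_thm_odd (q%:P) (- 'X) n.
rewrite -!mulrA -/c -!polyC_exp !DM Dc c1 (big_morph D DD D0) => E.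
apply: (@fX_lreg K ('C(n, 2) + n * n + n)).
transitivity ((-1) ^+ n.+1 * (q ^+ n * - (q ^+ ('C(n, 2) + n * n) * ((-1) ^+ n * (qpoch q n * qpoch q n))))).
  rewrite exprD exprS; set s := (-1) ^+ n.
  have : s * s = 1 by rewrite -exprD addnn -mul2n exprM sqrrN !expr1n.
  move: s (qpoch q n) (q ^+ _) (q ^+ n) => s p X Y ss.
  transitivity (s * s * (X * Y * (p * p))); last by ring.
  by rewrite ss mul1r.
rewrite E mulrCA; congr (_ * _); rewrite mulr_sumr; apply: eq_bigr => m _.
have := signs_cancel (fps K) (ltnSE (ltn_ord m)).
rewrite -!polyC_exp !gbin_polyC DM DD !DM !DX exprS exprD exprS.
have : (-1) ^+ n * (-1) ^+ n = 1 :> fps K by rewrite -exprD addnn -mul2n exprM sqrrN !expr1n.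
move: ((-1) ^+ n) ((-1) ^+ m) ((-1) ^+ (n - m)) => s t u ss su.
rewrite -su; move: (gbin _ _ _) (gbin _ _ _) (q ^+ _) (_%:R) (_%:R) => A B C E' F.
transitivity (s * s * (C * A * s * u * E') - s * C * B * u * F); first by ring.
by rewrite ss; ring.
Qed.

(** With n = 2N, a term of jacobi_finite either has its Gaussian binomials close
    to their limit or is divisible by q^N. *)
Lemma jacobi : euler ^+ 3 = sparse tri (fun m => (-1) ^+ m * (2 * m + 1)%:R).
Proof.
apply: eqmP => N; set n := (2 * N)%N.
have f_lim M : (N <= M)%N -> eqm N euler (qpoch q M).
  by move=> NM; rewrite -[euler]dil_id -[q]expr1; apply: euler_eqm.
have g_lim j : (N <= j)%N -> (N + j <= (n + n).+1)%N -> eqm N (euler * gbin q (n + n).+1 j) 1.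
  by move=> Nj jn; rewrite -[euler]dil_id -[q]expr1; apply: gbin_eqm.
apply: (@eqm_trans _ _ (euler * (qpoch q n * qpoch q n))).
  by rewrite exprS expr2; do !apply: eqmM => //; apply: f_lim; lia.
rewrite jacobi_finite mulr_sumr.
pose g m : fps K := (-1) ^+ m * (2 * m + 1)%:R * q ^+ tri m.
apply: (@eqm_trans _ _ (\sum_(m < n.+1) g m)); last first.
  apply: eqm_sym; apply: sparse_eqm => //; [exact: leq_tri| |lia].
  move=> m k; rewrite /g mulrAC mulrC cf_natrM cf_signXn.
  by rewrite -[RHS]mulrnAl [RHS]mulrC.
apply: eqm_sum => m _; rewrite mulrCA /g mulrC -mulrC -[X in eqm _ _ X]mulrC.
apply: eqm_XnM => lt_m; rewrite mulrCA; apply: eqmM => //.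
have {lt_m} lt_m : (m < N)%N := leq_ltn_trans (leq_tri m) lt_m.
rewrite mulrBr [euler * _]mulrCA [euler * (_%:R * _)]mulrCA.
have -> : (2 * m + 1)%:R = (n.+1 + m)%:R * 1 - (n - m)%:R * 1 :> fps K.
  by rewrite !mulr1 -natrB; [congr (_%:R)|]; lia.
by apply: eqmD; last apply: eqmN; apply: eqmM => //; apply: g_lim; lia.
Qed.

(** ** The theta series of the triangular numbers *)

(** The finite triple product at z = 1. It gives twice the identity, since the
    bilateral sum runs through each triangular number twice. *)
Lemma psi_prod : GRing.lreg (2%:R : fps K) ->
  sparse tri (fun=> 1) * euler = dil 2 euler ^+ 2.
Proof.
move=> reg2.
pose g : fps K := iprod (fun i => 1 + q ^+ i.+1).
have f_lim N M : (N <= M)%N -> eqm N euler (qpoch q M).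
  by move=> NM; rewrite -[euler]dil_id -[q]expr1; apply: euler_eqm.
have p_lim N M : (N <= M)%N -> eqm N g (\prod_(i < M) (1 + q ^+ i.+1)).
  by move=> NM; apply: iprod_eqm => // i; apply: eqm1D.
have gf : g * euler = dil 2 euler.
  apply: eqmP => N; apply: (@eqm_trans _ _ (qpoch (q ^+ 2) N)); last first.
    by apply: eqm_sym; apply: euler_eqm.
  apply: (@eqm_trans _ _ (\prod_(i < N) (1 + q ^+ i.+1) * qpoch q N)).
    by apply: eqmM; [apply: p_lim | apply: f_lim].
  rewrite -big_split /= /qpoch.
  suff -> : \prod_(i < N) ((1 + q ^+ i.+1) * (1 - q ^+ i.+1)) = \prod_(i < N) (1 - (q ^+ 2) ^+ i.+1) by [].
  by apply: eq_bigr => i _; rewrite -exprM mulnC exprM; ring.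
suff -> : sparse tri (fun=> 1) = euler * g ^+ 2 by rewrite -gf; ring.
apply: reg2; apply: eqmP => N; rewrite /=; set n := (2 * N)%N.
have g_lim j : (N <= j)%N -> (N + j <= (n + n).+1)%N -> eqm N (euler * gbin q (n + n).+1 j) 1.
  by move=> Nj jn; rewrite -[euler]dil_id -[q]expr1; apply: gbin_eqm.
set P := \prod_(i < n) (1 + q ^+ i.+1).
have E : 2%:R * P ^+ 2 = \sum_(m < n.+1) q ^+ tri m *
    (gbin q (n + n).+1 (n - m) + gbin q (n + n).+1 (n.+1 + m)).
  apply: (@fX_lreg K ('C(n, 2) + n * n + n)).
  have := gbin_thm_odd q 1 n; rewrite -mulrA halves_odd.
  have -> : \prod_(i < n) (1 + 1 * q ^+ i.+1) = P by apply: eq_bigr => i _; rewrite mul1r.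
  rewrite -/P => E'; transitivity (q ^+ n * (1 + 1) * (q ^+ ('C(n, 2) + n * n) * P * P)).
    by rewrite [in LHS]exprD; ring.
  rewrite E'; congr (_ * _); apply: eq_bigr => m _.
  by rewrite !expr1n !mulr1.
apply: (@eqm_trans _ _ (\sum_(m < n.+1) 2%:R * q ^+ tri m)).
  rewrite -mulr_sumr; apply: eqmM => //; apply: (@sparse_eqm _ _ _ (fun m => q ^+ tri m)) => [|m k|]; [exact: leq_tri| |lia].
  by rewrite cf_Xn eq_sym.
apply: eqm_sym; apply: (@eqm_trans _ _ (euler * (2%:R * P ^+ 2))).
  by rewrite mulrCA; do 2!apply: eqmM => //; apply: eqmX; apply: p_lim; lia.
rewrite E mulr_sumr; apply: eqm_sum => m _; rewrite mulrCA [2%:R * _]mulrC.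
apply: eqm_XnM => lt_m; have {lt_m} lt_m : (m < N)%N := leq_ltn_trans (leq_tri m) lt_m.
by rewrite mulrDr -[2%:R]/(1 + 1); apply: eqmD; apply: g_lim; lia.
Qed.

End Theta.

(** ** The theta series of the squares *)

Section ThetaSquares.
Variable K : comNzRingType.
Local Notation q := (fX K).
Local Notation euler := (euler K).

Definition odd_euler : fps K := iprod (fun i => 1 - q ^+ (2 * i + 1)).

Lemma odd_euler_eqm N M : (N <= M)%N ->
  eqm N odd_euler (\prod_(i < M) (1 - q ^+ (2 * i + 1))).
Proof. by move=> NM; apply: iprod_eqm => // i; apply: eqm1B; lia. Qed.

Lemma odd_eulerM : odd_euler * dil 2 euler = euler.
Proof.
apply: eqmP => N.
apply: (@eqm_trans _ _ (\prod_(i < N) (1 - q ^+ (2 * i + 1)) * qpoch (q ^+ 2) N)).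
  by apply: eqmM; [apply: odd_euler_eqm | apply: euler_eqm].
rewrite -[euler]dil_id; apply: eqm_sym.
have -> : \prod_(i < N) (1 - q ^+ (2 * i + 1)) * qpoch (q ^+ 2) N = qpoch (q ^+ 1) (2 * N).
  rewrite expr1; elim: N => [|N IHN]; first by rewrite /qpoch !big_ord0 mulr1.
  rewrite mulnS !addSn add0n !qpochS big_ord_recr /= -IHN -exprM addn1 mulnS.
  by rewrite !addSn add0n; ring.
by apply: euler_eqm => //; lia.
Qed.

(** The q-binomial theorem in base q^2 with 2n factors, y = q^(2n) and z = -q:
    this time the centred exponents are the squares. *)
Lemma odd_finite n (x := q ^+ 2) :
  (\prod_(i < n) (1 - q ^+ (2 * i + 1))) ^+ 2 =
    \sum_(k < n.+1) q ^+ (k ^ 2) * ((-1) ^+ k * gbin x (n + n) (n + k)) +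
    \sum_(k < n) q ^+ (k.+1 ^ 2) * ((-1) ^+ k.+1 * gbin x (n + n) (n - k.+1)).
Proof.
(* The common power of q: n^2 from the first n factors, 2 n^2 from the others. *)
apply: (@fX_lreg K (3 * n ^ 2)).
have E : \prod_(i < n + n) (x ^+ n + - q * x ^+ i) =
    (-1) ^+ n * (q ^+ (3 * n ^ 2) * (\prod_(i < n) (1 - q ^+ (2 * i + 1))) ^+ 2).
  rewrite big_split_ord /= expr2.
  have -> : \prod_(i < n) (x ^+ n + - q * x ^+ i) =
      (-1) ^+ n * (q ^+ (n ^ 2) * \prod_(i < n) (1 - q ^+ (2 * i + 1))).
    have -> : q ^+ (n ^ 2) = \prod_(i < n) q ^+ (2 * i + 1).
      elim: n => [|n IHn]; first by rewrite big_ord0.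
      by rewrite big_ord_recr /= -IHn -exprD; congr (_ ^+ _); lia.
    have -> : (-1) ^+ n = \prod_(i < n) -1 :> fps K by rewrite prodr_const card_ord.
    rewrite [X in _ = _ * (_ * X)](reindex_inj rev_ord_inj) -!big_split.
    apply: eq_bigr => i _ /=; rewrite mulN1r mulrBr mulr1 opprB -exprD /x -!exprM.
    rewrite mulNr -exprS; congr (q ^+ _ - q ^+ _); have := ltn_ord i; lia.
  have -> : \prod_(i < n) (x ^+ n + - q * x ^+ (n + i)) =
      q ^+ (2 * n ^ 2) * \prod_(i < n) (1 - q ^+ (2 * i + 1)).
    have -> : q ^+ (2 * n ^ 2) = \prod_(i < n) q ^+ (2 * n).
      by rewrite prodr_const card_ord -exprM; congr (_ ^+ _); lia.
    rewrite -big_split; apply: eq_bigr => i _ /=.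
    rewrite mulrBr mulr1 -exprD /x -!exprM mulNr -exprS; congr (q ^+ _ - q ^+ _); lia.
  have -> : (3 * n ^ 2 = n ^ 2 + 2 * n ^ 2)%N by lia.
  by rewrite exprD; ring.
have ss : (-1) ^+ n * (-1) ^+ n = 1 :> fps K by rewrite -exprD addnn -mul2n exprM sqrrN !expr1n.
transitivity ((-1) ^+ n * \prod_(i < n + n) (x ^+ n + - q * x ^+ i)).
  by rewrite E mulrA ss mul1r.
rewrite gbin_thm -addnS big_split_ord /= addrC !mulrDr.
have expE j : x ^+ 'C(j, 2) * (- q) ^+ j * (x ^+ n) ^+ (n + n - j)
    = (-1) ^+ j * q ^+ (2 * 'C(j, 2) + j + 2 * (n * (n + n - j))).
  rewrite [(- q) ^+ j]exprNn /x -!exprM mulrCA -mulrA -!exprD.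
  by congr (_ * q ^+ _); lia.
congr (_ + _); rewrite !mulr_sumr.
- apply: eq_bigr => k _; move: (nat_of_ord k) (ltnSE (ltn_ord k)) => {}k le_kn.
  have e : (2 * 'C(n + k, 2) + (n + k) + 2 * (n * (n + n - (n + k))) = 3 * n ^ 2 + k ^ 2)%N.
    rewrite bin2_dbl; have -> : (n + n - (n + k) = n - k)%N by lia.
    have := subnKC le_kn; move: (n - k)%N => d def_n.
    by rewrite -def_n; lia.
  transitivity ((-1) ^+ n * (gbin x (n + n) (n + k) *
     (x ^+ 'C(n + k, 2) * (- q) ^+ (n + k) * (x ^+ n) ^+ (n + n - (n + k))))).
    by rewrite !mulrA.
  rewrite expE e [q ^+ (_ + _)]exprD [(-1) ^+ (n + k)]exprD.
  move: ((-1) ^+ n) ((-1) ^+ k) (gbin _ _ _) (q ^+ _) (q ^+ _) ss => s t g A C ss.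
  transitivity (s * s * (t * (A * C) * g)); first by ring.
  by rewrite ss; ring.
- rewrite (reindex_inj rev_ord_inj); apply: eq_bigr => k _ /=.
  move: (nat_of_ord k) (ltn_ord k) => {}k le_kn.
  have e : (2 * 'C(n - k.+1, 2) + (n - k.+1) + 2 * (n * (n + n - (n - k.+1))) = 3 * n ^ 2 + k.+1 ^ 2)%N.
    rewrite bin2_dbl; have := subnKC le_kn; move: (n - k.+1)%N => d def_n.
    rewrite -def_n; have -> : (k.+1 + d + (k.+1 + d) - d = k.+1 + k.+1 + d)%N by lia.
    lia.
  transitivity ((-1) ^+ n * (gbin x (n + n) (n - k.+1) *
     (x ^+ 'C(n - k.+1, 2) * (- q) ^+ (n - k.+1) * (x ^+ n) ^+ (n + n - (n - k.+1))))).
    by rewrite !mulrA.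
  rewrite expE e [q ^+ (_ + _)]exprD -(signs_cancel _ le_kn).
  move: ((-1) ^+ n) ((-1) ^+ (n - k.+1)) (gbin _ _ _) (q ^+ _) (q ^+ _) => s t g A C.
  by ring.
Qed.

(** The sum of (-1)^k q^(k^2) over all integers k. *)
Definition theta_sq : fps K :=
  sparse (fun m => m ^ 2)%N (fun m => if m == 0%N then 1 else 2%:R * (-1) ^+ m).

Lemma leq_sq m : (m <= m ^ 2)%N. Proof. by case: m => // m; rewrite leq_pmulr. Qed.

Lemma theta_sq_odd : theta_sq = odd_euler ^+ 2 * dil 2 euler.
Proof.
apply: eqmP => N; set n := (2 * N)%N.
have g_lim j : (N <= j)%N -> (N + j <= n + n)%N ->
    eqm N (dil 2 euler * gbin (q ^+ 2) (n + n) j) 1 by exact: gbin_eqm.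
apply: (@eqm_trans _ _ (\sum_(k < n.+1) q ^+ (k ^ 2) * (-1) ^+ k +
   \sum_(k < n) q ^+ (k.+1 ^ 2) * (-1) ^+ k.+1)).
  pose g m : fps K := if m == 0%N then 1 else 2%:R * ((-1) ^+ m * q ^+ (m ^ 2)).
  apply: (@eqm_trans _ _ (\sum_(m < n.+1) g m)).
    apply: sparse_eqm => [m|m k|]; [exact: leq_sq| |lia].
    rewrite /g; case: eqP => [->|_]; first by rewrite cf1 eq_sym.
    by rewrite cf_natrM cf_signXn mulrnAr.
  rewrite !big_ord_recl /g /= mulr1 -addrA; apply: eqmD => //.
  rewrite -big_split /=; apply: eqm_sum => k _.
  by rewrite /bump /= add1n mulr_natl mulr2n [(-1) ^+ _ * _]mulrC.
apply: eqm_sym; apply: (@eqm_trans _ _ (dil 2 euler * (\prod_(i < n) (1 - q ^+ (2 * i + 1))) ^+ 2)).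
  by rewrite mulrC; apply: eqmM => //; apply: eqmX; apply: odd_euler_eqm; lia.
rewrite odd_finite mulrDr !mulr_sumr; apply: eqmD; apply: eqm_sum => k _;
  rewrite mulrCA; apply: eqm_XnM => lt_k;
  rewrite mulrCA -[X in eqm _ _ X]mulr1; apply: eqmM => //; apply: g_lim;
  have := leq_ltn_trans (leq_sq _) lt_k; lia.
Qed.

Lemma theta_sq_prod : theta_sq * dil 2 euler = euler ^+ 2.
Proof. by rewrite theta_sq_odd -[in RHS]odd_eulerM; ring. Qed.

End ThetaSquares.

(** * The generating function of the partition triples *)

Lemma is_part_cons x s : is_part (x :: s) = [&& (0 < x)%N, all (geq x) s & is_part s].
Proof.
rewrite /is_part /= path_sortedE; first by case: (0 < x)%N (all _ _) (sorted _ _) (all _ _) => [] [] [] [].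
by move=> y z t /= zy yt; apply: leq_trans yt zy.
Qed.

Lemma distinct_odd_cons x s : is_distinct_odd_part (x :: s) =
  [&& odd x, all (gtn x) s & is_distinct_odd_part s].
Proof.
rewrite /is_distinct_odd_part is_part_cons /=.
have -> : all (gtn x) s = (all (geq x) s && (x \notin s)).
  elim: s => //= y s ->; rewrite inE negb_or ltn_neqAle eq_sym.
  by case: (x == y) (y <= x)%N (all _ _) (x \in s) => [] [] [] [].
case: x => [|x] /=; first by rewrite ?andbF.
by case: (all (geq _) _) (is_part s) (_ \in s) (uniq s) (odd x) (all odd s) => [] [] [] [] [] [].
Qed.

Lemma mul4_cons x s : is_mul4_part (x :: s) =
  [&& (4 %| x)%N, (0 < x)%N, all (geq x) s & is_mul4_part s].
Proof.
rewrite /is_mul4_part is_part_cons /=.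
by case: (4 %| x)%N (0 < x)%N (all (geq _) _) (is_part s) => [] [] [] [].
Qed.

Fixpoint odd_parts (m n : nat) : seq (seq nat) :=
  if m is m'.+1 then
    odd_parts m' n ++
      if odd m' && (m' <= n)%N then [seq m' :: s | s <- odd_parts m' (n - m')%N] else [::]
  else if n == 0%N then [:: [::]] else [::].

Lemma mem_odd_parts m n s :
  (s \in odd_parts m n) = [&& is_distinct_odd_part s, all (gtn m) s & sumn s == n].
Proof.
elim: m n s => [|m IHm] n s /=.
  case: s => [|x s] /=; last by rewrite andbF; case: ifP => // _; rewrite inE.
  by rewrite eq_sym; case: eqP => // _; rewrite inE.
rewrite mem_cat IHm; case: s => [|x s].
  rewrite [X in _ || X](_ : _ = false) ?orbF //.
  by case: ifP => // _; apply/mapP => -[].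
rewrite distinct_odd_cons /= ltnS [(x <= m)%N]leq_eqVlt.
have [->|ne_xm] /= := eqVneq x m.
  rewrite ltnn /= !andbF /=.
  have [lt_s|] := boolP (all (gtn m) s); last first.
    move=> nlt_s; rewrite andbF /=; case: ifP => // _; apply/mapP => -[t].
    by rewrite IHm => /and3P[_ lt_t _] [E]; rewrite E lt_t in nlt_s.
  have -> : all (gtn m.+1) s = true by apply: sub_all lt_s => y /= /ltnW.
  case: (boolP (odd m)) => //= _; case: leqP => [le_mn|lt_nm].
    rewrite mem_map; last by move=> ? ? [].
    by rewrite IHm lt_s andTb -{2}(subnKC le_mn) eqn_add2l.
  by rewrite andbC; case: eqP => // E; rewrite -E ltnNge leq_addr in lt_nm.
rewrite [X in _ || X](_ : _ = false) ?orbF; last first.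
  by case: ifP => // _; apply/mapP => -[t _ [E _]]; rewrite E eqxx in ne_xm.
case: (boolP (x < m)%N) => [lt_xm|]; rewrite ?andbF //=.
have [lt_s|] := boolP (all (gtn x) s); last by rewrite andbF.
have -> : all (gtn m) s = true by apply: sub_all lt_s => y /= /ltn_trans; apply.
by have -> : all (gtn m.+1) s = true by apply: sub_all lt_s => y /= /ltn_trans; apply; apply: ltnW.
Qed.

Lemma uniq_odd_parts m n : uniq (odd_parts m n).
Proof.
elim: m n => [|m IHm] n /=; first by case: ifP.
rewrite cat_uniq IHm /=; case: ifP => // _; rewrite map_inj_uniq ?IHm ?andbT; last by move=> ? ? [].
apply/hasPn => _ /mapP[t _ ->] /=; rewrite mem_odd_parts /= ltnn.
by rewrite !andbF.
Qed.

(** A part m' may be repeated, so that m does not decrease in the second call;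
    the bound k makes the recursion structural and is harmless if m + n <= k. *)
Fixpoint mul4_parts (k m n : nat) : seq (seq nat) :=
  if k is k'.+1 then
    if m is m'.+1 then
      mul4_parts k' m' n ++
        if [&& 4 %| m', 0 < m' & m' <= n]%N
        then [seq m' :: s | s <- mul4_parts k' m (n - m')%N] else [::]
    else if n == 0%N then [:: [::]] else [::]
  else if n == 0%N then [:: [::]] else [::].

Lemma mem_mul4_parts0 n s : (s \in (if n == 0%N then [:: [::]] else [::])) =
  [&& is_mul4_part s, all (gtn 0%N) s & sumn s == n].
Proof.
case: s => [|x s] /=; last by rewrite andbF; case: ifP => // _; rewrite inE.
by rewrite eq_sym; case: eqP => // _; rewrite inE.
Qed.

Lemma mem_mul4_parts k m n s : (m + n <= k)%N ->
  (s \in mul4_parts k m n) = [&& is_mul4_part s, all (gtn m) s & sumn s == n].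
Proof.
elim: k m n s => [|k IHk] [|m] n s; rewrite ?mem_mul4_parts0 //.
rewrite addSn ltnS => le_k.
rewrite [mul4_parts _ _ _]/= mem_cat IHk //; case: s => [|x s].
  rewrite [X in _ || X](_ : _ = false) ?orbF //.
  by case: ifP => // _; apply/mapP => -[].
rewrite mul4_cons /= ltnS [(x <= m)%N]leq_eqVlt.
have [->|ne_xm] /= := eqVneq x m.
  rewrite ltnn /= !andbF /=.
  case: (boolP (4 %| m)%N) => //= _; case: (boolP (0 < m)%N) => //= m_gt0.
  case: leqP => [le_mn|lt_nm]; last first.
    have -> : (m + sumn s == n)%N = false by lia.
    by rewrite in_nil !andbF.
  rewrite mem_map; last by move=> ? ? [].
  rewrite IHk; last by lia.
  rewrite -{2}(subnKC le_mn) eqn_add2l /=.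
  have -> : all (geq m) s = all (gtn m.+1) s by apply: eq_all => y /=; rewrite ltnS.
  by case: (is_mul4_part s) (all _ _) => [] [].
rewrite [X in _ || X](_ : _ = false) ?orbF; last first.
  by case: ifP => // _; apply/mapP => -[t _ [E _]]; rewrite E eqxx in ne_xm.
case: (boolP (x < m)%N) => [lt_xm|]; rewrite ?andbF //=.
have [lt_s|] := boolP (all (geq x) s); last by rewrite !andbF.
have -> : all (gtn m) s = true by apply: sub_all lt_s => y /= /leq_ltn_trans; apply.
have -> // : all (gtn m.+1) s = true.
by apply: sub_all lt_s => y /= /leq_ltn_trans; apply; apply: ltnW.
Qed.

Lemma uniq_mul4_parts k m n : (m + n <= k)%N -> uniq (mul4_parts k m n).
Proof.
elim: k m n => [|k IHk] [|m] n; try by case: n.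
rewrite addSn ltnS => le_k /=; rewrite cat_uniq IHk //=.
case: ifP => [/and3P[_ m_gt0 le_mn]|//].
rewrite map_inj_uniq ?IHk ?andbT; [|lia|by move=> ? ? []].
apply/hasPn => _ /mapP[t _ ->] /=; rewrite mem_mul4_parts //= ltnn.
by rewrite !andbF.
Qed.

Lemma size_mul4_parts k k' m n : (m + n <= k)%N -> (m + n <= k')%N ->
  size (mul4_parts k m n) = size (mul4_parts k' m n).
Proof.
move=> le_k le_k'; apply/perm_size/uniq_perm; rewrite ?uniq_mul4_parts // => s.
by rewrite !mem_mul4_parts.
Qed.

Section GeneratingFunctions.
Variable K : comNzRingType.
Local Notation q := (fX K).

Definition odd_series m : fps K := Fps (fun n => (size (odd_parts m n))%:R).
Definition mul4_series m : fps K := Fps (fun n => (size (mul4_parts (m + n) m n))%:R).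

Lemma odd_seriesS m :
  odd_series m.+1 = odd_series m * (1 + if odd m then q ^+ m else 0).
Proof.
apply/fpsP => n; rewrite mulrDr mulr1 cfD.
have -> : cf (odd_series m.+1) n = cf (odd_series m) n +
    (if odd m && (m <= n)%N then (size (odd_parts m (n - m)))%:R else 0).
  by rewrite [LHS]/= size_cat natrD; case: ifP; rewrite ?size_map.
congr (_ + _); case: (odd m); last by rewrite mulr0.
by rewrite mulrC cf_Xnmul /=.
Qed.

Lemma mul4_seriesS m :
  mul4_series m = mul4_series m.+1 * (1 - if (4 %| m)%N && (0 < m)%N then q ^+ m else 0).
Proof.
apply/fpsP => n; rewrite mulrBr mulr1 cfB.
have -> : cf (mul4_series m.+1) n = (size (mul4_parts (m + n) m n))%:R +
    (if [&& 4 %| m, 0 < m & m <= n]%N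
     then (size (mul4_parts (m + n) m.+1 (n - m)))%:R else 0).
  by rewrite [LHS]/= size_cat natrD; case: ifP; rewrite ?size_map.
rewrite andbA; case: (boolP ((4 %| m) && (0 < m))%N) => [/andP[_ m_gt0]|_]; rewrite ?andTb ?andFb.
  rewrite mulrC cf_Xnmul; case: ifP => [le_mn|_]; last by rewrite addr0 subr0.
  have -> : cf (mul4_series m.+1) (n - m) = (size (mul4_parts (m + n) m.+1 (n - m)))%:R.
    by congr (_%:R); apply: size_mul4_parts; lia.
  by rewrite addrK.
by rewrite mulr0 subr0 addr0.
Qed.

Lemma odd_series_prod M : odd_series (2 * M) = \prod_(i < M) (1 + q ^+ (2 * i + 1)).
Proof.
elim: M => [|M IHM].
  by rewrite big_ord0; apply/fpsP => -[|n].
rewrite mulnS !addSn add0n !odd_seriesS big_ord_recr /= -IHM addn1.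
by rewrite mul2n odd_double /= addr0 mulr1.
Qed.

Lemma mul4_series_prod M : mul4_series (4 * M).+1 * qpoch (q ^+ 4) M = 1.
Proof.
have S1 m : ~~ (4 %| m)%N -> mul4_series m.+1 = mul4_series m.
  by move=> /negPf m4; rewrite [RHS]mul4_seriesS m4 subr0 mulr1.
elim: M => [|M IHM].
  rewrite qpoch0 mulr1; have := mul4_seriesS 0; rewrite andbF subr0 mulr1 => <-.
  by apply/fpsP => -[|n].
have -> : (4 * M.+1 = (4 * M).+4)%N by lia.
rewrite qpochS mulrA mulrAC -exprM.
have -> : (4 * M.+1 = (4 * M).+4)%N by lia.
have := mul4_seriesS (4 * M).+4.
have -> : (4 %| (4 * M).+4)%N by rewrite -(addn4 (4 * M)) dvdn_add ?dvdn_mulr.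
have not4 j : (0 < j < 4)%N -> ~~ (4 %| j + 4 * M)%N.
  by move=> j4; rewrite dvdn_addl ?dvdn_mulr // gtnNdvd; lia.
have n1 := not4 1%N isT; have n2 := not4 2 isT; have n3 := not4 3 isT.
move=> <-; rewrite (S1 _ n3) (S1 _ n2) (S1 _ n1); exact: IHM.
Qed.
End GeneratingFunctions.

(** Links the cardinals in the definition of B with explicit enumerations. *)
Lemma card_bseq_parts n j (P : pred (seq nat)) (r : seq (seq nat)) : (j <= n)%N ->
    uniq r -> (forall s, (s \in r) = P s && (sumn s == j)) ->
    (forall s, P s -> is_part s) ->
  #|[pred t : n.-bseq 'I_n.+1 | P (bseq_parts t) && (sumn (bseq_parts t) == j)]| = size r.
Proof.
move=> le_jn Ur mem_r partP; rewrite cardE -(size_map (@bseq_parts n)).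
apply/perm_size/uniq_perm => // [|s].
  by rewrite map_inj_uniq ?enum_uniq //; apply: bseq_parts_inj.
rewrite mem_r; apply/mapP/andP => [[t + ->]|[Ps /eqP sum_s]].
  by rewrite mem_enum inE => /andP.
have [|t def_s] := @is_part_bseq n s (partP s Ps); first by rewrite sum_s.
by exists t; rewrite // mem_enum inE def_s Ps sum_s eqxx.
Qed.

Section GeneratingFunctionB.
Variable K : comNzRingType.
Local Notation q := (fX K).

Definition Bseries : fps K := Fps (fun n => (B n)%:R).
Definition odd_gen : fps K := iprod (fun i => 1 + q ^+ (2 * i + 1)).

(** Sums over the finite type that represents sequences in the definition of B;
    only the coefficients up to n are meaningful. *)
Definition part_sum n (P : pred (seq nat)) : fps K :=
  \sum_(t : n.-bseq 'I_n.+1 | P (bseq_parts t)) q ^+ sumn (bseq_parts t).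

Lemma part_sum_coef n j (P : pred (seq nat)) (r : seq (seq nat)) : (j <= n)%N ->
    uniq r -> (forall s, (s \in r) = P s && (sumn s == j)) ->
    (forall s, P s -> is_part s) ->
  cf (part_sum n P) j = (size r)%:R.
Proof.
move=> le_jn Ur mem_r partP; rewrite -(card_bseq_parts le_jn Ur mem_r partP).
rewrite cf_sum -sum1_card natr_sum big_mkcondr /=; apply: eq_bigr => t _.
by rewrite cf_Xn eq_sym; case: eqP.
Qed.

Lemma all_gtn_sumn s n : (sumn s <= n)%N -> all (gtn n.+1) s.
Proof.
elim: s n => //= x s IHs n le_n; rewrite ltnS (leq_trans (leq_addr _ _) le_n).
by apply: IHs; apply: leq_trans le_n; apply: leq_addl.
Qed.

Lemma Bseries_trunc n : eqm n.+1 (odd_series K n.+1 ^+ 2 * mul4_series K n.+1)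
  (part_sum n is_distinct_odd_part ^+ 2 * part_sum n is_mul4_part).
Proof.
have mem_sum (P : pred (seq nat)) j s : (j <= n)%N ->
    [&& P s, all (gtn n.+1) s & sumn s == j] = P s && (sumn s == j).
  move=> le_jn; congr (_ && _); case: eqP; rewrite ?andbF // => E.
  by rewrite all_gtn_sumn // E.
apply: eqmM; first apply: eqmX; move=> j; rewrite ltnS => le_jn.
- rewrite (part_sum_coef le_jn (uniq_odd_parts n.+1 j)) // => s.
    by rewrite mem_odd_parts mem_sum.
  by case/and3P.
- rewrite (part_sum_coef le_jn (uniq_mul4_parts (leqnn (n.+1 + j)))) // => s.
    by rewrite mem_mul4_parts // mem_sum.
  by case/andP.
Qed.

(** Multiplying out the sums over representatives gives a sum over triples, of
    which the coefficient n keeps those of total n. *)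
Lemma cf_Bseries n : cf Bseries n = cf (odd_series K n.+1 ^+ 2 * mul4_series K n.+1) n.
Proof.
have mul3 a b c : cf (q ^+ a * q ^+ b * q ^+ c) n = ((a + b + c)%N == n)%:R.
  by rewrite -!exprD cf_Xn eq_sym.
rewrite (Bseries_trunc (ltnSn n)) /part_sum expr2 big_distrlr pair_big.
rewrite big_distrlr pair_big cf_sum [LHS]/= /B.
rewrite -sum1_card natr_sum big_mkcond [RHS]big_mkcond; apply: eq_bigr => -[[t1 t2] t3] _.
rewrite mul3 inE /is_part_triple /=.
by case: (is_distinct_odd_part _) (is_distinct_odd_part _) (is_mul4_part _) (_ == n) => [] [] [] [].
Qed.

Lemma odd_series_eqm N M : (N <= 2 * M)%N -> eqm N (odd_series K N) (odd_series K (2 * M)).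
Proof.
elim: (2 * M)%N => [|m IHm]; first by rewrite leqn0 => /eqP->.
rewrite leq_eqVlt => /predU1P[->//|]; rewrite ltnS => le_Nm.
apply: eqm_trans (IHm le_Nm) _; rewrite odd_seriesS -[X in eqm _ X _]mulr1.
apply: eqmM => //; apply: eqm_sym; case: ifP => _; first exact: eqm1D.
by rewrite addr0.
Qed.

Lemma mul4_series_eqm N M : (N <= M)%N -> eqm N (mul4_series K N) (mul4_series K M).
Proof.
elim: M => [|m IHm]; first by rewrite leqn0 => /eqP->.
rewrite leq_eqVlt => /predU1P[->//|]; rewrite ltnS => le_Nm.
apply: eqm_trans (IHm le_Nm) _; rewrite mul4_seriesS -[X in eqm _ _ X]mulr1.
apply: eqmM => //; case: ifP => _; first exact: eqm1B.
by rewrite subr0.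
Qed.

Lemma Bseries_prod : Bseries * dil 4 (euler K) = odd_gen ^+ 2.
Proof.
apply: eqmP => N.
apply: (@eqm_trans _ _ (odd_series K (2 * N) ^+ 2 * mul4_series K (4 * N).+1 * qpoch (q ^+ 4) N)).
  apply: eqmM; last exact: euler_eqm.
  move=> n nN; rewrite cf_Bseries.
  suff H : eqm n.+1 (odd_series K n.+1 ^+ 2 * mul4_series K n.+1)
      (odd_series K (2 * N) ^+ 2 * mul4_series K (4 * N).+1) by exact: H.
  apply: eqmM; first by apply: eqmX; apply: odd_series_eqm; lia.
  by apply: mul4_series_eqm; lia.
rewrite -mulrA mul4_series_prod mulr1; apply: eqmX; apply: eqm_sym.
rewrite odd_series_prod; apply: iprod_eqm => // i; apply: eqm1D; lia.
Qed.

Lemma alt_dil k x : ~~ odd k -> alt (dil k x) = dil k x :> fps K.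
Proof.
move=> k2; apply/fpsP => n /=; case: ifP => [/dvdnP[m ->]|]; last by rewrite mulr0.
by rewrite -signr_odd oddM (negPf k2) andbF mul1r.
Qed.

Lemma alt_odd_gen : alt odd_gen = odd_euler K.
Proof.
apply: eqmP => N; apply: (@eqm_trans _ _ (alt (\prod_(i < N) (1 + q ^+ (2 * i + 1))))).
  by apply: eqm_alt; apply: iprod_eqm => // i; apply: eqm1D; lia.
apply: eqm_sym; apply: (@eqm_trans _ _ (\prod_(i < N) (1 - q ^+ (2 * i + 1)))).
  exact: odd_euler_eqm.
rewrite (big_morph (@alt K) (@altM K) (@alt1 K)).
suff -> : \prod_(i < N) (1 - q ^+ (2 * i + 1)) = \prod_(i < N) alt (1 + q ^+ (2 * i + 1)) by [].
apply: eq_bigr => i _; rewrite altD alt1 altX alt_fX [(- q) ^+ _]exprNn addn1.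
by rewrite [(-1) ^+ _]exprS exprM sqrrN !expr1n mulr1 mulN1r.
Qed.

(** Changing the sign of q turns the factors 1 + q^(2i+1) of odd_gen into the
    1 - q^(2i+1), whose product is f / f(q^2) for the Euler product f. *)
Lemma alt_Bseries_prod :
  alt Bseries * (dil 2 (euler K) ^+ 2 * dil 2 (dil 2 (euler K))) = euler K ^+ 2.
Proof.
have -> : dil 2 (dil 2 (euler K)) = dil 4 (euler K) by rewrite dil_dil.
rewrite mulrCA mulrC -(alt_dil (euler K) (isT : ~~ odd 4)) -altM Bseries_prod.
by rewrite altX alt_odd_gen -exprMn odd_eulerM.
Qed.
End GeneratingFunctionB.

(** * Dissections of the theta series modulo 3 *)

Section Dissections.
Variable K : comNzRingType.
Local Notation q := (fX K).
Local Notation V := (dil 3).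

Lemma mulrn_eq (x : K) (a b c d : nat) : (a = b <-> c = d) -> x *+ (a == b) = x *+ (c == d).
Proof.
move=> E; congr (_ *+ _); congr nat_of_bool.
by apply/eqP/eqP => /E.
Qed.

Lemma mulrn_neq (x : K) (a b : nat) : a <> b -> x *+ (a == b) = 0.
Proof. by move/eqP/negPf->. Qed.

Lemma tri_mod3 j :
  [/\ tri (3 * j) = (3 * (3 * tri j - j))%N, tri (3 * j + 1) = (3 * (3 * tri j) + 1)%N &
      tri (3 * j + 2) = (3 * (3 * tri j + j + 1))%N].
Proof.
have := tri_dbl (3 * j); have := tri_dbl (3 * j + 1); have := tri_dbl (3 * j + 2).
have := tri_dbl j; have := leq_tri j.
by move=> *; split; lia.
Qed.

(** A triangular number is 1 modulo 3 only for the index 3j + 1, and then it is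
    9 tri j + 1. *)
Lemma sec1_sparse_tri (c : nat -> K) :
  sec 1 (sparse tri c) = V (sparse tri (fun j => c (3 * j + 1)%N)).
Proof.
apply/fpsP => n; rewrite [LHS](cf_sparse _ (M := 3 * (3 * n + 2))); [|exact: leq_tri|lia].
rewrite (sum_mod3 (fun m => c m *+ (tri m == (3 * n + 1)%N))) cf_dil.
transitivity (\sum_(j < 3 * n + 2) c (3 * j + 1)%N *+ ((3 * tri j)%N == n)).
  apply: eq_bigr => j _; have [t0 t1 t2] := tri_mod3 j.
  rewrite t0 t1 t2 [X in X + _ + _]mulrn_neq; last by lia.
  rewrite [X in _ + _ + X]mulrn_neq; last by lia.
  by rewrite add0r addr0; apply: mulrn_eq; lia.
case: ifP => [/dvdnP[m ->]|n3].
  rewrite mulnK // (cf_sparse _ (M := 3 * (m * 3) + 2)) //; [|exact: leq_tri|lia].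
  by apply: eq_bigr => j _; apply: mulrn_eq; lia.
rewrite big1 // => j _; apply: mulrn_neq => E; by rewrite -E dvdn_mulr in n3.
Qed.

Lemma sec2_sparse_tri (c : nat -> K) : sec 2 (sparse tri c) = 0.
Proof.
apply/fpsP => n; rewrite [LHS](cf_sparse _ (M := 3 * (3 * n + 3))); [|exact: leq_tri|lia].
rewrite (sum_mod3 (fun m => c m *+ (tri m == (3 * n + 2)%N))) big1 // => j _.
have [t0 t1 t2] := tri_mod3 j.
by rewrite t0 t1 t2 !mulrn_neq ?addr0 //; lia.
Qed.

(** The sum of (-1)^k q^(3k^2+2k) over all integers k, split into k = j and
    k = -(j+1) for natural numbers j. *)
Definition gamma : fps K :=
  sparse (fun j => 3 * j ^ 2 + 2 * j)%N (fun j => (-1) ^+ j) -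
  sparse (fun j => 3 * j ^ 2 + 4 * j + 1)%N (fun j => (-1) ^+ j).

Lemma sign3 (j : nat) : (-1) ^+ (3 * j) = (-1) ^+ j :> K.
Proof. by rewrite exprM -signr_odd. Qed.

Lemma theta_sq_coef n M : (n < M)%N -> cf (theta_sq K) n =
  \sum_(m < M) (if m == 0%N :> nat then 1 else 2%:R * (-1) ^+ m) *+ (m ^ 2 == n)%N.
Proof. by move=> nM; rewrite (cf_sparse _ (M := M)) // => m; apply: leq_sq. Qed.

(** The squares prime to 3 are those of 3k + 1 for integers k, and (3k + 1)^2 is
    3 (3k^2 + 2k) + 1. *)
Lemma theta_sq_dissection :
  [/\ sec 0 (theta_sq K) = V (theta_sq K), sec 1 (theta_sq K) = - (2%:R * gamma) &
      sec 2 (theta_sq K) = 0].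
Proof.
pose c m : K := if m == 0%N then 1 else 2%:R * (-1) ^+ m.
pose M n := (3 * n + 3)%N.
have cfE r n : (r < 3)%N -> cf (sec r (theta_sq K)) n =
   \sum_(j < M n) (c (3 * j)%N *+ (3 * (3 * j ^ 2) == 3 * n + r)%N
      + c (3 * j + 1)%N *+ (3 * (3 * j ^ 2 + 2 * j) + 1 == 3 * n + r)%N
      + c (3 * j + 2)%N *+ (3 * (3 * j ^ 2 + 4 * j + 1) + 1 == 3 * n + r)%N).
  move=> r3; rewrite cf_sec (@theta_sq_coef _ (3 * M n)); last by rewrite /M; lia.
  rewrite (sum_mod3 (fun m => c m *+ (m ^ 2 == 3 * n + r)%N)).
  by apply: eq_bigr => j _; congr (_ + _ + _); apply: mulrn_eq; lia.
split; apply/fpsP => n; rewrite cfE //.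
- transitivity (\sum_(j < M n) c j *+ (3 * j ^ 2 == n)%N).
    apply: eq_bigr => j _; rewrite [X in _ + X + _]mulrn_neq; last by lia.
    rewrite [X in _ + _ + X]mulrn_neq; last by lia.
    rewrite !addr0 /c muln_eq0 sign3 /=; apply: mulrn_eq; lia.
  rewrite cf_dil; case: ifP => [/dvdnP[m ->]|n3].
    rewrite mulnK // [RHS](@theta_sq_coef _ (M (m * 3))); last by rewrite /M; lia.
    by apply: eq_bigr => j _; apply: mulrn_eq; move: (j ^ 2)%N => k; lia.
  rewrite big1 // => j _; apply: mulrn_neq => E; by rewrite -E dvdn_mulr in n3.
- rewrite cfN cf_natrM cfB !(cf_sparse _ (M := M n)); try by rewrite /M; lia.
  rewrite -sumrB mulr_sumr -sumrN; apply: eq_bigr => j _.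
  rewrite [X in X + _ + _]mulrn_neq; last by lia.
  rewrite /c !addn_eq0 !andbF [(-1) ^+ (3 * j + 1)]exprD [(-1) ^+ (3 * j + 2)]exprD !sign3 add0r.
  rewrite (@mulrn_eq _ (3 * (3 * j ^ 2 + 2 * j) + 1) _ (3 * j ^ 2 + 2 * j) n); last by lia.
  rewrite (@mulrn_eq _ (3 * (3 * j ^ 2 + 4 * j + 1) + 1) _ (3 * j ^ 2 + 4 * j + 1) n); last by lia.
  by case: eqP => _; case: eqP => _; rewrite ?mulr1n ?mulr0n; ring.
- rewrite big1 // => j _; by rewrite !mulrn_neq ?addr0 //; lia.
Qed.
End Dissections.

(** * Series modulo 9 *)

Local Notation Z9 := 'Z_9.
Local Notation R := (fps Z9).
Local Notation q := (fX Z9).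
Local Notation V := (dil 3).

Lemma VM (x y : R) : V (x * y) = V x * V y. Proof. exact: dilM. Qed.
Lemma VD (x y : R) : V (x + y) = V x + V y. Proof. exact: dilD. Qed.
Lemma VB (x y : R) : V (x - y) = V x - V y. Proof. exact: dilB. Qed.
Lemma VX (x : R) n : V (x ^+ n) = V x ^+ n. Proof. exact: dilX. Qed.
Lemma V1 : V (1 : R) = 1. Proof. exact: dil1. Qed.
Lemma Vq : V q = q ^+ 3. Proof. exact: dil_fX. Qed.

Lemma nine0 : 9%:R = 0 :> R.
Proof.
apply/fpsP => n; rewrite cf_natr cf0; case: ifP => // _; exact/eqP.
Qed.

Lemma Z9_cube (c : Z9) : 3%:R * c ^+ 3 = 3%:R * c.
Proof. by case: c; do 9?[case=> [?|]; first exact/eqP]. Qed.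

Lemma Z9_div3 (c : Z9) : 3%:R * c = 0 -> c = 3%:R * (c %/ 3)%:R.
Proof.
move/eqP; case: c; do 9?[case=> [i|]; first by move=> h; apply/eqP; move: h].
by [].
Qed.

Lemma div3 (x : R) : 3%:R * x = 0 -> exists y, x = 3%:R * y.
Proof.
move=> x0; exists (Fps (fun n => (cf x n %/ 3)%:R)); apply/fpsP => n.
by rewrite cf_natrM; apply: Z9_div3; rewrite -cf_natrM x0.
Qed.

Lemma two_lreg : GRing.lreg (2%:R : R).
Proof.
move=> x y /= xy; rewrite -[x]mul1r -[y]mul1r.
have -> : 1 = 5%:R * 2%:R - 9%:R :> R by ring.
by rewrite nine0 subr0 -!mulrA xy.
Qed.

Definition fC (c : Z9) : R := Fps (fun n => c *+ (n == 0%N)).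

Lemma fCM c d : fC (c * d) = fC c * fC d.
Proof.
apply/fpsP => n; rewrite cfM big_ord_recl big1 => [|i _]; last by rewrite /= mul0r.
by rewrite addr0 /= subn0 mulrnAr.
Qed.

Lemma fC_cube c : 3%:R * fC c ^+ 3 = 3%:R * fC c.
Proof.
rewrite !exprS expr0 mulr1 -!fCM.
apply/fpsP => n; rewrite !cf_natrM /= !mulrnAr.
by have := Z9_cube c; rewrite !exprS expr0 mulr1 => ->.
Qed.

Lemma dil_fC k c : (0 < k)%N -> dil k (fC c) = fC c.
Proof.
move=> k0; apply/fpsP => n; rewrite cf_dil /=; case: ifP => [/dvdnP[m ->]|].
  by rewrite mulnK // muln_eq0 (gtn_eqF k0) orbF.
by case: eqP => // ->; rewrite dvdn0.
Qed.

(** The Frobenius endomorphism modulo 3. Congruences modulo 3 are written as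
    equalities modulo 9 of the triples. *)
Lemma cube_mod3 (x : R) : 3%:R * x ^+ 3 = 3%:R * V x.
Proof.
apply: eqmP => N; pose t := \sum_(i < N) fC (cf x i) * q ^+ i.
have xt : eqm N x t.
  move=> n nN; rewrite cf_sum (bigD1 (Ordinal nN)) // big1 => [|i ne_in].
    by rewrite [RHS]addr0 mulrC cf_Xnmul leqnn subnn.
  rewrite mulrC cf_Xnmul; case: ifP => // le_in /=.
  rewrite subn_eq0 leqNgt ltn_neqAle le_in andbT.
  by have -> : i != n :> nat by [].
apply: (@eqm_trans _ _ (3%:R * t ^+ 3)); first by apply: eqmM => //; apply: eqmX.
apply: (@eqm_trans _ _ (3%:R * V t)); last first.
  by apply: eqmM => //; apply: eqm_sym; apply: eqm_dil.
suff -> : 3%:R * t ^+ 3 = 3%:R * V t by [].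
rewrite /t; elim: {xt t}N => [|N IHN].
  by rewrite big_ord0 dil0 expr0n.
rewrite big_ord_recr /= dilD mulrDr -IHN.
set a := \sum_(i < N) _; set c := fC _.
transitivity (3%:R * a ^+ 3 + 3%:R * c ^+ 3 * (q ^+ N) ^+ 3
  + 9%:R * (a ^+ 2 * (c * q ^+ N) + a * (c * q ^+ N) ^+ 2)); first by ring.
rewrite nine0 mul0r addr0 fC_cube dilM // dil_fC // dilX // dil_fX //.
by rewrite -!exprM mulnC mulrA.
Qed.

Lemma mod3_lin (c d l r A B : R) :
  3%:R * l = 3%:R * r -> A = B + c * (l - r) + 3%:R * d -> 3%:R * A = 3%:R * B.
Proof.
move=> lr ->; transitivity (3%:R * B + c * (3%:R * l - 3%:R * r) + 9%:R * d); first by ring.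
by rewrite lr nine0 subrr mulr0 mul0r !addr0.
Qed.

Lemma mod3M (a b c d : R) :
  3%:R * a = 3%:R * b -> 3%:R * c = 3%:R * d -> 3%:R * (a * c) = 3%:R * (b * d).
Proof. by move=> ab cd; rewrite mulrA ab -!mulrA mulrCA cd mulrCA. Qed.

Lemma mod3X (a b : R) n : 3%:R * a = 3%:R * b -> 3%:R * a ^+ n = 3%:R * b ^+ n.
Proof.
move=> ab; elim: n => [|n IHn]; first by rewrite !expr0.
rewrite exprS [b ^+ _]exprS; exact: mod3M ab IHn.
Qed.

Lemma mod3_cancel (u a b : R) : cf u 0 = 1 ->
  3%:R * (u * a) = 3%:R * (u * b) -> 3%:R * a = 3%:R * b.
Proof. by move=> /fps_lreg reg; rewrite ![3%:R * (u * _)]mulrCA => /reg. Qed.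

(** ** The zeroth section of a cube *)

Lemma sec_cube_div3 r (x : R) : r = 1%N \/ r = 2 -> 3%:R * sec r (x ^+ 3) = 0.
Proof.
have [_ V1 V2] := secV x.
by move=> [] ->; rewrite -sec_natrM cube_mod3 sec_natrM (V1, V2) mulr0.
Qed.

Definition sec0_cube (x : R) : R := sec 0 (x ^+ 3).

(** The other two sections of a cube are divisible by 3, so their products
    vanish modulo 9. *)
Lemma sec0_cubeM x y : sec0_cube (x * y) = sec0_cube x * sec0_cube y.
Proof.
rewrite /sec0_cube exprMn sec0M.
have /div3[a ->] := @sec_cube_div3 1 x (or_introl erefl).
have /div3[b ->] := @sec_cube_div3 2 x (or_intror erefl).
have /div3[c ->] := @sec_cube_div3 1 y (or_introl erefl).
have /div3[d ->] := @sec_cube_div3 2 y (or_intror erefl).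
transitivity (sec 0 (x ^+ 3) * sec 0 (y ^+ 3) + 9%:R * (q * (a * d + b * c))); first by ring.
by rewrite nine0 mul0r addr0.
Qed.

Lemma sec0_cube1 : sec0_cube 1 = 1.
Proof. by have [V0 _ _] := secV (1 : R); rewrite /sec0_cube expr1n -{1}V1 V0. Qed.

Lemma sec0_Xn k : sec 0 (q ^+ k) = if (3 %| k)%N then q ^+ (k %/ 3) else 0.
Proof.
apply/fpsP => n; rewrite cf_sec cf_Xn addn0; case: ifP => [/dvdnP[m ->]|k3].
  by rewrite mulnK // cf_Xn mulnC eqn_pmul2r.
by rewrite cf0; case: eqP => // E; rewrite -E dvdn_mulr in k3.
Qed.

Lemma sec0_cube_factor j :
  [/\ sec0_cube (1 - q ^+ (3 * j + 1)) = 1 - q ^+ (3 * j + 1),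
      sec0_cube (1 - q ^+ (3 * j + 2)) = 1 - q ^+ (3 * j + 2) &
      sec0_cube (1 - q ^+ (3 * j + 3)) = (1 - q ^+ j.+1) ^+ 3].
Proof.
have not3 k : ~~ (3 %| k)%N -> sec0_cube (1 - q ^+ k) = 1 - q ^+ k.
  move=> k3; rewrite /sec0_cube.
  have -> : (1 - q ^+ k) ^+ 3 = q ^+ 0 - 3%:R * q ^+ k + 3%:R * q ^+ (2 * k) - q ^+ (3 * k).
    by rewrite [(2 * k)%N]mulnC [(3 * k)%N]mulnC !exprM expr0; ring.
  rewrite !(secD, secN, sec_natrM) !sec0_Xn dvdn0 (negPf k3) Gauss_dvdr // (negPf k3).
  by rewrite dvdn_mulr // mulKn // !mulr0 subr0 addr0.
split; [by apply: not3; lia|by apply: not3; lia|].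
have [V0 _ _] := secV ((1 - q ^+ j.+1) ^+ 3).
rewrite /sec0_cube -[RHS]V0; congr sec.
have -> : (3 * j + 3 = 3 * j.+1)%N by lia.
by rewrite VX VB V1 VX Vq -exprM.
Qed.

Local Notation f := (euler Z9).

(** By multiplicativity: the factors 1 - q^n with n prime to 3 are fixed by
    sec0_cube, and together they give f / V f; the others give f^3. *)
Lemma sec0_cube_euler : sec0_cube f * V f = f * f ^+ 3.
Proof.
apply: eqmP => N.
have f_lim M : (N <= M)%N -> eqm N f (qpoch q M).
  by move=> NM; rewrite -[f]dil_id -[q]expr1; apply: euler_eqm.
apply: (@eqm_trans _ _ (sec0_cube (qpoch q (3 * N)) * qpoch (q ^+ 3) N)).
  apply: eqmM; last exact: euler_eqm.
  have H : eqm (3 * N) (f ^+ 3) (qpoch q (3 * N) ^+ 3).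
    by apply: eqmX; rewrite -[f]dil_id -[q]expr1; apply: euler_eqm.
  by move=> n nN; rewrite /sec0_cube !cf_sec; apply: H; lia.
have -> : sec0_cube (qpoch q (3 * N)) * qpoch (q ^+ 3) N = qpoch q (3 * N) * qpoch q N ^+ 3.
  elim: N {f_lim} => [|N IHN].
    by rewrite muln0 !qpoch0 sec0_cube1 expr1n.
  have [] := sec0_cube_factor N; rewrite addn1 addn2 addn3 => E1 E2 E3.
  rewrite mulnS !addSn add0n !qpochS !sec0_cubeM E1 E2 E3 -exprM mulnS !addSn add0n.
  set a := qpoch q (3 * N); rewrite -/a in IHN.
  transitivity (sec0_cube a * qpoch (q ^+ 3) N * ((1 - q ^+ (3 * N).+1) *
    (1 - q ^+ (3 * N).+2) * (1 - q ^+ (3 * N).+3) * (1 - q ^+ N.+1) ^+ 3)).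
    move: (sec0_cube a) (qpoch _ N) (1 - q ^+ _) (1 - q ^+ _) (1 - q ^+ _) (1 - q ^+ _).
    by move=> *; ring.
  rewrite IHN; move: {IHN E1 E2 E3} a (qpoch _ N) (1 - q ^+ _) (1 - q ^+ _) (1 - q ^+ _) (1 - q ^+ _).
  by move=> *; ring.
by apply: eqm_sym; apply: eqmM; [|apply: eqmX]; apply: f_lim; lia.
Qed.

(** ** Compatibility with doubling *)

Local Notation S := (dil 2).

Lemma SM (x y : R) : S (x * y) = S x * S y. Proof. exact: dilM. Qed.
Lemma SN (x : R) : S (- x) = - S x. Proof. exact: dilN. Qed.
Lemma SX (x : R) n : S (x ^+ n) = S x ^+ n. Proof. exact: dilX. Qed.
Lemma S_natr n : S (n%:R : R) = n%:R. Proof. exact: dil_natr. Qed.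
Lemma V_natr n : V (n%:R : R) = n%:R. Proof. exact: dil_natr. Qed.
Lemma SV (x : R) : S (V x) = V (S x).
Proof. by rewrite !dil_dil. Qed.
Lemma Sq : S q = q ^+ 2. Proof. exact: dil_fX. Qed.
Lemma mod3D (a b c d : R) :
  3%:R * a = 3%:R * b -> 3%:R * c = 3%:R * d -> 3%:R * (a + c) = 3%:R * (b + d).
Proof. by move=> ab cd; rewrite !mulrDr ab cd. Qed.

Lemma mod3_S (x y : R) : 3%:R * x = 3%:R * y -> 3%:R * S x = 3%:R * S y.
Proof. by move/(congr1 S); rewrite !SM S_natr. Qed.
Lemma secVM r (u x : R) : (r < 3)%N -> sec r (V u * x) = u * sec r x.
Proof. exact: sec_dilM. Qed.

Lemma cube_sections (a b : R) :
  sec 1 ((V a + q * V b) ^+ 3) = 3%:R * (a ^+ 2 * b) /\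
  sec 2 ((V a + q * V b) ^+ 3) = 3%:R * (a * b ^+ 2).
Proof.
have -> : (V a + q * V b) ^+ 3 = V (a ^+ 3 + q * b ^+ 3) + q * V (3%:R * (a ^+ 2 * b))
    + q ^+ 2 * V (3%:R * (a * b ^+ 2)).
  by rewrite !(VD, VM, VX, V_natr, Vq); move: (V a) (V b) => a' b'; ring.
by have [_ -> ->] := sec_dissection (a ^+ 3 + q * b ^+ 3)
  (3%:R * (a ^+ 2 * b)) (3%:R * (a * b ^+ 2)).
Qed.

(** Write b and c for S a and S (S a). The hypothesis and its image under S
    give b = (a - qc)^2 modulo 3, hence a factorization of b^3. *)
Lemma quartic_mod3 (a : R) : cf a 0 = 1 ->
    3%:R * (a * S a) = 3%:R * (a ^+ 3 + q * S a ^+ 3) ->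
  3%:R * S a ^+ 3 = 3%:R * (a * S (S a) * (a + q * S (S a))).
Proof.
move=> a0 E1; have E2 := mod3_S E1.
rewrite SM dilD SX SM Sq SX in E2.
move: (S a) (S (S a)) E1 E2 => b c E1 E2.
have B : 3%:R * b = 3%:R * (a - q * c) ^+ 2.
  apply: (@mod3_cancel (a - q * c)).
    by rewrite cfB a0 cf_Xmul subr0.
  transitivity (3%:R * (a * b) - q * (3%:R * (b * c))); first by ring.
  rewrite E1 E2.
  transitivity (3%:R * ((a - q * c) * (a - q * c) ^+ 2)
     + 9%:R * (a ^+ 2 * q * c - a * q ^+ 2 * c ^+ 2)); first by ring.
  by rewrite nine0 mul0r addr0.
transitivity (3%:R * (b * c) - 3%:R * (q ^+ 2 * c ^+ 3)); first by rewrite E2; ring.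
rewrite -mulrBr; apply: (@mod3_lin c (- (a * q * c ^+ 2)) _ _ _ _ B).
ring.
Qed.

Lemma reg_dil (x : R) k : cf x 0 = 1 -> GRing.lreg (dil k x).
Proof. by move=> x0; apply: fps_lreg; rewrite cf_dil0. Qed.

Lemma mod3_V (x : R) : 3%:R * V x = 3%:R * x ^+ 3.
Proof. by rewrite cube_mod3. Qed.

Lemma sec2_qM (x : R) : sec 2 (q * x) = sec 1 x.
Proof.
apply/fpsP => n; rewrite !cf_sec cf_Xmul.
by have -> : (3 * n + 2 = (3 * n + 1).+1)%N by lia.
Qed.

(** ** Logarithms of cubes *)

(** Since x^3 is V x modulo 3, a cube differs from V x by a factor 1 + 3 l, and
    modulo 9 such factors multiply by adding the l; l is a logarithm, known
    modulo 3. *)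
Definition cube_log (x l : R) := x ^+ 3 = V x * (1 + 3%:R * l).

Lemma cube_logM x x' l l' :
  cube_log x l -> cube_log x' l' -> cube_log (x * x') (l + l').
Proof.
rewrite /cube_log exprMn VM => -> ->.
transitivity (V x * V x' * (1 + 3%:R * (l + l')) + 9%:R * (V x * V x' * l * l')).
  by move: (V x) (V x') => a b; ring.
by rewrite nine0 mul0r addr0.
Qed.

Lemma cube_log_div x x' l m : cf x 0 = 1 ->
  cube_log x l -> cube_log (x' * x) m -> cube_log x' (m - l).
Proof.
move=> x0 hx; rewrite /cube_log exprMn VM hx => E; apply: (reg_dil (k := 3) x0).
transitivity (V x * x' ^+ 3 + 9%:R * (- (V x * x' ^+ 3 * l * l))).
  by rewrite nine0 mul0r addr0.
transitivity (x' ^+ 3 * (V x * (1 + 3%:R * l)) * (1 - 3%:R * l)).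
  by move: (V x) (x' ^+ 3) => a b; ring.
rewrite E; transitivity (V x * (V x' * (1 + 3%:R * (m - l))) + 9%:R * (- (V x * V x' * m * l))).
  by move: (V x) (V x') => a b; ring.
by rewrite nine0 mul0r addr0.
Qed.

Lemma cube_log_S x l : cube_log x l -> cube_log (S x) (S l).
Proof.
by rewrite /cube_log -SX => ->; rewrite SM SV dilD SM S_natr (dil1 _ (isT : 0 < 2)%N).
Qed.

(** ** Three successive sections modulo 9 *)

(** The left-hand side is x^2 d (x F1), in which h1 and h2 replace x j1 and x j2
    by expressions in a and X. *)
Lemma sec1_computation (x X j1 j2 a a3 g p F1 d j : R) :
    X = x ^+ 3 * d -> d = 1 + 3%:R * j ->
    3%:R * (a ^+ 2 * X) = - (3%:R * (x * j1)) ->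
    3%:R * (a * X ^+ 2) = - (3%:R * (x * j2)) ->
    3%:R * a3 = 3%:R * a ^+ 3 ->
    x * F1 = (p * a + q * (- (2%:R * g) * X)) * (3%:R * j1) + p * X * d
              + q * (- (2%:R * g) * a * (3%:R * j2)) ->
  X * F1 = X * (p * (x ^+ 2 * d ^+ 2) + 3%:R * (x * (q * (X * (g * a ^+ 2)) - p * a3))).
Proof.
move=> hX hd h1 h2 h3 hF.
have d3 : 3%:R * d = 3%:R.
  by rewrite hd; transitivity (3%:R + 9%:R * j); [ring | rewrite nine0 mul0r addr0].
transitivity (x ^+ 2 * d * (x * F1)); first by rewrite {1}hX; ring.
rewrite hF; transitivity (p * X * x ^+ 2 * d ^+ 2
   - x * d * ((p * a + q * (- (2%:R * g) * X)) * - (3%:R * (x * j1))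
       + q * (- (2%:R * g) * a * - (3%:R * (x * j2))))); first by ring.
rewrite -h1 -h2; transitivity (p * X * x ^+ 2 * d ^+ 2
  - x * (3%:R * d) * (p * a ^+ 3 * X - 4%:R * q * g * a ^+ 2 * X ^+ 2)); first by ring.
rewrite d3; transitivity (p * X * x ^+ 2 * d ^+ 2 - x * (3%:R * a ^+ 3) * p * X
   + 3%:R * x * q * g * a ^+ 2 * X ^+ 2 + 9%:R * (x * q * g * a ^+ 2 * X ^+ 2)); first by ring.
by rewrite nine0 mul0r addr0 -h3; ring.
Qed.

(** By h1 and h2 the terms with j1 and j2 contribute -12 a^3 X^2 and -6 a^3 X^2,
    which cancel modulo 9. *)
Lemma sec2_computation (x X j j1 j2 a d : R) :
    d = 1 + 3%:R * j ->
    3%:R * (a ^+ 2 * X) = - (3%:R * (x * j1)) ->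
    3%:R * (a * X ^+ 2) = - (3%:R * (x * j2)) ->
  x * (a ^+ 2 * (6%:R * j2) + 2%:R * a * X * (6%:R * j1) + X ^+ 2 * d ^+ 2) = x * (X ^+ 2 * d ^+ 2).
Proof.
move=> hd h1 h2.
transitivity (- 2%:R * a ^+ 2 * - (3%:R * (x * j2)) - 4%:R * a * X * - (3%:R * (x * j1)) + x * (X ^+ 2 * d ^+ 2)); first by ring.
rewrite -h1 -h2; transitivity (x * (X ^+ 2 * d ^+ 2) - 9%:R * (2%:R * a ^+ 3 * X ^+ 2)); first by ring.
by rewrite nine0 mul0r subr0.
Qed.

(** Here f is the Euler product, y = S f^2 / f the theta series of the triangular
    numbers, th = f^2 / S f that of the squares with alternating signs; the
    theorem depends on them only through the properties below. *)
Section Core.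
Variables f y th ga : R.
Hypothesis f0 : cf f 0 = 1.
Hypothesis y0 : cf y 0 = 1.
Hypothesis th0 : cf th 0 = 1.
Hypothesis f_cube0 : sec 0 (f ^+ 3) * V f = f * f ^+ 3.
Hypothesis f_cube1 : sec 1 (f ^+ 3) = - (3%:R * V f ^+ 3).
Hypothesis f_cube2 : sec 2 (f ^+ 3) = 0.
Hypothesis yf : y * f = S f ^+ 2.
Hypothesis y_sec1 : sec 1 y = V y.
Hypothesis y_sec2 : sec 2 y = 0.
Hypothesis thf : th * S f = f ^+ 2.
Hypothesis th_sec0 : sec 0 th = V th.
Hypothesis th_sec1 : sec 1 th = - (2%:R * ga).
Hypothesis th_sec2 : sec 2 th = 0.

Lemma reg_f : GRing.lreg f. Proof. exact: fps_lreg. Qed.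
(** L is minus the logarithm of f^3 / V f. Its section 0 is L itself by f_cube0, and
    Jacobi's identity gives the other two. *)
Lemma cube_quotient_f : exists L : R,
  [/\ f ^+ 3 = V f * (1 - 3%:R * L), 3%:R * sec 0 L = 3%:R * L,
      3%:R * (f * sec 1 L) = 3%:R * V f ^+ 3 & 3%:R * sec 2 L = 0].
Proof.
have [u fu] := fps_unit f0.
have VfVu : V f * V u = 1 by rewrite -VM fu V1.
have [L hL] : exists L, 1 - f ^+ 3 * V u = 3%:R * L.
  apply: div3; rewrite mulrBr mulr1 mulrA cube_mod3 -mulrA VfVu mulr1; exact: subrr.
have fL : f ^+ 3 = V f * (1 - 3%:R * L).
  rewrite -hL; transitivity (f ^+ 3 * (V f * V u)); first by rewrite VfVu mulr1.
  by move: (V f) (V u) (f ^+ 3) => a b c; ring.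
have sec1L r : (r < 3)%N -> sec r (f ^+ 3) = f * (sec r 1 - 3%:R * sec r L).
  by move=> r3; rewrite fL (secVM _ _ r3) secB sec_natrM.
have [V10 V11 V12] := secV (1 : R); rewrite V1 in V10 V11 V12.
exists L; split.
- exact: fL.
- have := f_cube0; rewrite (sec1L 0%N isT) V10 fL.
  rewrite -mulrA [_ * V f]mulrC => /reg_f /(reg_dil f0) /addrI /oppr_inj.
  exact.
- have := f_cube1; rewrite (sec1L 1%N isT) V11 sub0r mulrN => /oppr_inj <-.
  by rewrite mulrCA.
- have := f_cube2; rewrite (sec1L 2%N isT) V12 sub0r -[RHS](mulr0 f) => /reg_f /eqP; rewrite oppr_eq0 => /eqP.
  exact.
Qed.

Section Log.
Variable L : R.
Hypothesis fL : f ^+ 3 = V f * (1 - 3%:R * L).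
Hypothesis L0 : 3%:R * sec 0 L = 3%:R * L.
Hypothesis L1 : 3%:R * (f * sec 1 L) = 3%:R * V f ^+ 3.
Hypothesis L2 : 3%:R * sec 2 L = 0.

(* J is minus the logarithm of y^3 / V y, computed from y f = S f^2. *)
Let J := 2%:R * S L - L.
Let al := sec 0 y.
Let Y := V y.
Let G := S ga.

Lemma cube_log_f : cube_log f (- L).
Proof. by rewrite /cube_log mulrN. Qed.

Lemma cube_log_y : cube_log y (- J).
Proof.
have -> : - J = (- S L - S L) - (- L) by rewrite /J; ring.
apply: cube_log_div f0 cube_log_f _; rewrite yf expr2.
by apply: cube_logM; rewrite -SN; apply: cube_log_S cube_log_f.
Qed.

Lemma cube_log_th : cube_log th (S L - 2%:R * L).
Proof.
have -> : S L - 2%:R * L = (- L - L) - (- S L) by ring.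
have Sf0 : cf (S f) 0 = 1 by rewrite cf_dil0.
apply: (cube_log_div Sf0); first by rewrite -SN; apply: cube_log_S cube_log_f.
by rewrite thf expr2; apply: cube_logM; apply: cube_log_f.
Qed.

Lemma SL_sections :
  [/\ 3%:R * sec 0 (S L) = 3%:R * S L, 3%:R * sec 1 (S L) = 0 &
      3%:R * sec 2 (S L) = 3%:R * S (sec 1 L)].
Proof.
have [-> -> ->] := sec_dil2 L; split=> //.
- by rewrite -[in LHS](S_natr 3) -SM L0 SM S_natr.
- by rewrite mulrCA -[in LHS](S_natr 3) -SM L2 dil0 mulr0.
Qed.

Lemma J_sections :
  [/\ 3%:R * sec 0 J = 3%:R * J, 3%:R * sec 1 J = - (3%:R * sec 1 L) &
      3%:R * sec 2 J = 6%:R * S (sec 1 L)].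
Proof.
have [S0 S1 S2] := SL_sections.
have E r : 3%:R * sec r J = 2%:R * (3%:R * sec r (S L)) - 3%:R * sec r L.
  by rewrite /J secB sec_natrM; ring.
split; rewrite E.
- by rewrite S0 L0 /J; ring.
- by rewrite S1 mulr0 sub0r.
- by rewrite S2 L2; ring.
Qed.

Lemma y_dissection : y = V al + q * V Y.
Proof. by rewrite {1}(dissection y) y_sec1 y_sec2 dil0 mulr0 addr0. Qed.

Lemma y_cube_sections :
  sec 1 (y ^+ 3) = 3%:R * (al ^+ 2 * Y) /\ sec 2 (y ^+ 3) = 3%:R * (al * Y ^+ 2).
Proof. by rewrite {1 2}y_dissection; apply: cube_sections. Qed.

(** Comparing the two expressions for the cube of y, section by section. *)
Lemma al_J :
  3%:R * (al ^+ 2 * Y) = - (3%:R * (y * sec 1 J)) /\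
  3%:R * (al * Y ^+ 2) = - (3%:R * (y * sec 2 J)).
Proof.
have [<- <-] := y_cube_sections; have [_ V11 V12] := secV (1 : R).
rewrite V1 in V11 V12.
have E r : (r < 3)%N -> sec r (y ^+ 3) = y * (sec r 1 - 3%:R * sec r J).
  move=> r3; rewrite cube_log_y (secVM _ _ r3) secD sec_natrM secN; congr (_ * _).
  by rewrite mulrN.
by rewrite (E 1%N isT) (E 2 isT) V11 V12; split; ring.
Qed.

(** The section al as a product modulo 3, read off from the section 2 of y^3. *)
Lemma al_prod : 3%:R * (al * S f ^+ 2) = 3%:R * f ^+ 5.
Proof.
have [_ _ J2] := J_sections; have [_ alJ] := al_J.
have E1 : 3%:R * (S f * (al * Y ^+ 2)) = 3%:R * (y * V (S f) ^+ 3).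
  rewrite mulrCA alJ; transitivity (- (S f * y) * (3%:R * sec 2 J)); first by ring.
  have SL1 : 3%:R * (S f * S (sec 1 L)) = 3%:R * V (S f) ^+ 3.
    by have := congr1 S L1; rewrite (SM _ (V f ^+ 3)) (SM _ (f * _)) (SM f) SX SV S_natr.
  rewrite J2; transitivity (- (2%:R * y) * (3%:R * (S f * S (sec 1 L)))); first by ring.
  rewrite SL1; transitivity (3%:R * (y * V (S f) ^+ 3) - 9%:R * (y * V (S f) ^+ 3)).
    by move: (V _) => a; ring.
  by rewrite nine0 mul0r subr0.
have E2 : 3%:R * (al * y ^+ 5) = 3%:R * S f ^+ 8.
  apply: (@mod3_cancel (S f * y)).
    by rewrite cfM0 y0 cf_dil0 f0 mulr1.
  transitivity (3%:R * (S f * (al * Y ^+ 2))).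
    have E : 3%:R * (S f * al * Y ^+ 2) = 3%:R * (S f * al * (y ^+ 3) ^+ 2).
      exact: mod3M (erefl _) (mod3X 2 (mod3_V y)).
    move: E; move: al Y (S f) => a b c E.
    transitivity (3%:R * (c * a * (y ^+ 3) ^+ 2)); first by ring.
    by rewrite -E; ring.
  have E : 3%:R * (y * V (S f) ^+ 3) = 3%:R * (y * (S f ^+ 3) ^+ 3).
    exact: mod3M (erefl _) (mod3X 3 (mod3_V (S f))).
  by rewrite E1 E; move: (S f) => a; ring.
apply: (@mod3_cancel (S f ^+ 8)); first by rewrite -SX cf_dil0 cfX0 f0 expr1n.
apply: (@mod3_lin (f ^+ 5) 0 _ _ _ _ E2).
have -> : S f ^+ 8 * (al * S f ^+ 2) = al * (S f ^+ 2) ^+ 5.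
  by move: (S f) => a; ring.
by rewrite -yf; move: (S f) => a; ring.
Qed.

(** The series ga as a product modulo 3, read off from the section 1 of th^3. *)
Lemma ga_prod : 3%:R * (ga * f ^+ 2) = 3%:R * S f ^+ 5.
Proof.
have [_ SL1 _] := SL_sections.
have th_dissection : th = V (V th) + q * V (- (2%:R * ga)).
  by rewrite {1}(dissection th) th_sec0 th_sec1 th_sec2 dil0 mulr0 addr0.
have [_ V11 _] := secV (1 : R); rewrite V1 in V11.
have E1 : 3%:R * (V th ^+ 2 * ga) = 3%:R * (th * sec 1 L).
  have [E _] := cube_sections (V th) (- (2%:R * ga)); move: E.
  rewrite -th_dissection cube_log_th (secVM _ _ (isT : (1 < 3)%N)) secD sec_natrM V11 add0r.
  rewrite secB sec_natrM mulrBr SL1 sub0r.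
  move: (V th) (sec 1 L) => a l E.
  transitivity (- 5%:R * (3%:R * (a ^+ 2 * - (2%:R * ga))) - 9%:R * (3%:R * (a ^+ 2 * ga))); first by ring.
  rewrite -E; transitivity (3%:R * (th * l) + 9%:R * (3%:R * (th * l) - 3%:R * (a ^+ 2 * ga))); first by ring.
  by rewrite nine0 mul0r addr0.
have E2 : 3%:R * (th ^+ 5 * ga) = 3%:R * f ^+ 8.
  apply: (@mod3_cancel (f * th)); first by rewrite cfM0 f0 th0 mulr1.
  transitivity (3%:R * (f * (V th ^+ 2 * ga))).
    have E : 3%:R * (f * ga * V th ^+ 2) = 3%:R * (f * ga * (th ^+ 3) ^+ 2).
      exact: mod3M (erefl _) (mod3X 2 (mod3_V th)).
    move: E; move: (V th) => a E; transitivity (3%:R * (f * ga * (th ^+ 3) ^+ 2)); first by ring.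
    by rewrite -E; ring.
  transitivity (f * (3%:R * (V th ^+ 2 * ga))); first by rewrite mulrCA.
  rewrite E1; transitivity (th * (3%:R * (f * sec 1 L))); first by move: (sec 1 L) => l; ring.
  rewrite L1.
  have E : 3%:R * (th * V f ^+ 3) = 3%:R * (th * (f ^+ 3) ^+ 3).
    exact: mod3M (erefl _) (mod3X 3 (mod3_V f)).
  by rewrite mulrCA E; ring.
apply: (@mod3_cancel (f ^+ 8)); first by rewrite cfX0 f0 expr1n.
apply: (@mod3_lin (S f ^+ 5) 0 _ _ _ _ E2).
have -> : f ^+ 8 * (ga * f ^+ 2) = ga * (f ^+ 2) ^+ 5 by ring.
by rewrite -thf; move: (S f) => a; ring.
Qed.

Lemma G_prod : 3%:R * (G * S f ^+ 2) = 3%:R * S (S f) ^+ 5.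
Proof.
have := mod3_S ga_prod.
have -> : S (ga * f ^+ 2) = G * S f ^+ 2 by rewrite SM SX.
by rewrite SX.
Qed.

(** The dissection of y, read modulo 3, as a relation between f and S f. *)
Lemma euler_cubic :
  3%:R * (f ^+ 8 * S (f ^+ 8)) = 3%:R * ((f ^+ 8) ^+ 3 + q * S (f ^+ 8) ^+ 3).
Proof.
rewrite SX.
have Y9 : 3%:R * V Y = 3%:R * y ^+ 9.
  by rewrite mod3_V (mod3X 3 (mod3_V y)) -exprM.
have E : 3%:R * y = 3%:R * (al ^+ 3 + q * y ^+ 9).
  rewrite {1}y_dissection !mulrDr mod3_V [3%:R * (q * _)]mulrCA Y9; congr (_ + _).
  exact: mulrCA.
have al6 : 3%:R * (al * S f ^+ 2) ^+ 3 = 3%:R * (f ^+ 5) ^+ 3 := mod3X 3 al_prod.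
have {}E : 3%:R * (f ^+ 9 * S f ^+ 6 * y) = 3%:R * (f ^+ 9 * S f ^+ 6 * (al ^+ 3 + q * y ^+ 9)).
  exact: mod3M (erefl _) E.
have yf9 : (y * f) ^+ 9 = (S f ^+ 2) ^+ 9 by rewrite yf.
transitivity (3%:R * (f ^+ 9 * S f ^+ 6 * y)).
  transitivity (3%:R * (f ^+ 8 * S f ^+ 6 * S f ^+ 2)); first by move: (S f) => a; ring.
  by rewrite -yf; move: (S f) => a; ring.
rewrite E -!exprM; apply: (@mod3_lin (f ^+ 9) 0 _ _ _ _ al6).
move: yf9; move: al (S f) => a g yf9.
transitivity (f ^+ 9 * (a * g ^+ 2) ^+ 3 + q * g ^+ 6 * (y * f) ^+ 9); first by ring.
by rewrite yf9; ring.
Qed.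

(** ** The three sections *)

Variable F : R.
Hypothesis F_prod : F * (S f ^+ 2 * S (S f)) = f ^+ 2.

Let ph := S th.
(* D is V y / y^3, which turns F = ph / y^2 into ph y D / V y: the denominator
   becomes a series in q^3 and goes through the sections. *)
Let D := 1 + 3%:R * J.

Lemma ph_prod : ph * S (S f) = S f ^+ 2.
Proof. by rewrite -SX -thf SM. Qed.

Lemma ph_sections :
  [/\ sec 0 ph = V ph, sec 1 ph = 0 & sec 2 ph = - (2%:R * G)].
Proof.
have [-> -> ->] := sec_dil2 th.
by rewrite th_sec0 SV th_sec2 dil0 mulr0 th_sec1 SN SM S_natr.
Qed.

Lemma y_sections : [/\ sec 0 y = al, sec 1 y = Y & sec 2 y = 0].
Proof. by []. Qed.

Lemma D_sections :
  [/\ sec 0 D = D, sec 1 D = 3%:R * sec 1 J & sec 2 D = 3%:R * sec 2 J].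
Proof.
have [V10 V11 V12] := secV (1 : R); rewrite V1 in V10 V11 V12.
have [] := J_sections; rewrite /D; move: J => j J0 _ _.
by rewrite !secD !sec_natrM V10 V11 V12 J0 !add0r.
Qed.

Lemma Y_D : Y = y ^+ 3 * D.
Proof.
rewrite cube_log_y /D -/Y.
transitivity (Y - 9%:R * (Y * J ^+ 2)); first by rewrite nine0 mul0r subr0.
by move: Y J => a b; ring.
Qed.

Lemma F_ph : F * y ^+ 2 = ph.
Proof.
have reg : GRing.lreg (f ^+ 2 * (S f ^+ 2 * S (S f))).
  by apply: fps_lreg; rewrite !cfM0 !cf_dil0 f0 !mulr1.
apply: reg; transitivity ((y * f) ^+ 2 * (F * (S f ^+ 2 * S (S f)))).
  by move: (S f) (S (S f)) => a b; ring.
rewrite F_prod yf; transitivity (f ^+ 2 * S f ^+ 2 * S f ^+ 2).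
  by move: (S f) => a; ring.
by rewrite -{2}ph_prod; move: ph (S f) (S (S f)) => c a b; ring.
Qed.

Lemma first_section : sec 1 F = V ph * (y ^+ 2 * D ^+ 2)
  + 3%:R * (y * (q * (Y * (G * al ^+ 2)) - V ph * V al)).
Proof.
apply: (@reg_dil y 3 y0); rewrite -/Y.
have [y_0 y_1 y_2] := y_sections; have [p0 p1 p2] := ph_sections.
have [D0 D1 D2] := D_sections; have [h1 h2] := al_J.
apply: (sec1_computation Y_D (erefl D) h1 h2 (mod3_V al)).
have FY : V y * F = ph * y * D.
  by rewrite -/Y Y_D -F_ph; move: D => d; ring.
have := congr1 (sec 1) FY; rewrite (secVM _ _ (isT : (1 < 3)%N)) => ->.
rewrite sec1M sec0M (sec1M ph) (sec2M ph) y_0 y_1 y_2 p0 p1 p2 D0 D1 D2.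
by move: (sec 1 J) (sec 2 J) D Y al G (V ph) => *; ring.
Qed.

(** Modulo 3 this series is S y times a series in the cube of the variable, and
    twice a triangular number is never 1 modulo 3. *)
Lemma sec1_yGal : 3%:R * sec 1 (y * (G * al ^+ 2)) = 0.
Proof.
have Sy : S y * S f = S (S f) ^+ 2 by rewrite -SM yf SX.
have E : 3%:R * (V (S f) * (y * (G * al ^+ 2))) = 3%:R * (V (f ^+ 3 * S (S f)) * S y).
  transitivity (3%:R * (S f ^+ 3 * (y * (G * al ^+ 2)))).
    exact: mod3M (mod3_V _) (erefl _).
  transitivity (3%:R * ((f ^+ 3 * S (S f)) ^+ 3 * S y)); last first.
    by apply: mod3M (erefl _); rewrite mod3_V.
  apply: (@mod3_cancel (f * S f ^+ 6)); first by rewrite cfM0 !cfX0 cf_dil0 f0 !expr1n mulr1.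
  have E1 := mod3M G_prod (mod3X 2 al_prod).
  transitivity (S f ^+ 5 * (3%:R * (G * S f ^+ 2 * (al * S f ^+ 2) ^+ 2))).
    transitivity (3%:R * ((y * f) * S f ^+ 9 * (G * al ^+ 2))).
      by move: (S f) G al => *; ring.
    by rewrite yf; move: (S f) G al => *; ring.
  rewrite E1; transitivity (3%:R * (f ^+ 10 * S (S f) ^+ 3 * S f ^+ 5 * S (S f) ^+ 2)).
    by move: (S f) (S (S f)) => *; ring.
  by rewrite -Sy; move: (S y) (S f) (S (S f)) => *; ring.
have := congr1 (sec 1) E; rewrite !sec_natrM !(secVM _ _ (isT : (1 < 3)%N)).
have [_ -> _] := sec_dil2 y; rewrite y_sec2 dil0 !mulr0 mulrCA -[RHS](mulr0 (S f)).
exact: reg_dil f0 _ _.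
Qed.

Lemma D2_sections :
  [/\ sec 0 (D ^+ 2) = D ^+ 2, sec 1 (D ^+ 2) = 6%:R * sec 1 J & sec 2 (D ^+ 2) = 6%:R * sec 2 J].
Proof.
have D2E : D ^+ 2 = 1 + 2%:R * (D - 1).
  transitivity (1 + 2%:R * (D - 1) + 9%:R * J ^+ 2); first by rewrite /D; ring.
  by rewrite nine0 mul0r addr0.
have [V10 V11 V12] := secV (1 : R); rewrite V1 in V10 V11 V12.
have := D_sections; rewrite D2E; move: D (sec 1 J) (sec 2 J) => d j1 j2 [D0 D1 D2].
rewrite !secD !sec_natrM !secB V10 V11 V12 D0 D1 D2.
by split; [|ring|ring].
Qed.

(** The 3-multiple in first_section contributes nothing here, by sec1_yGal and
    because y has no section 2; in the rest sec2_computation applies. *)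
Lemma second_section : sec 2 (sec 1 F) = ph * (Y ^+ 2 * D ^+ 2).
Proof.
have [y_0 y_1 y_2] := y_sections; have [h1 h2] := al_J.
have [D0 D1 D2] := D2_sections.
rewrite first_section secD sec_natrM (secVM _ _ (isT : (2 < 3)%N)).
have -> : 3%:R * sec 2 (y * (q * (Y * (G * al ^+ 2)) - V ph * V al)) = 0.
  have -> : y * (q * (Y * (G * al ^+ 2)) - V ph * V al)
      = Y * (q * (y * (G * al ^+ 2))) - V (ph * al) * y.
    by rewrite VM; move: Y G (V ph) (V al) => *; ring.
  rewrite secB /Y !(secVM _ _ (isT : (2 < 3)%N)) sec2_qM y_sec2 mulr0 subr0.
  by rewrite mulrCA sec1_yGal mulr0.
rewrite addr0; congr (_ * _); apply: (fps_lreg y0).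
rewrite -(sec2_computation (erefl D) h1 h2); congr (_ * _).
rewrite sec2M D0 D1 D2 expr2 sec0M sec1M sec2M y_0 y_1 y_2.
by move: al Y (sec 1 J) (sec 2 J) D => *; ring.
Qed.

(** As D^2 is 1 modulo 3 and ph has no section 1, only multiples of 3 are left. *)
Lemma third_section : sec 1 (sec 2 (sec 1 F)) = 3%:R * (y * Y * al * (V ph * al + q * (G * Y))).
Proof.
have [p0 p1 p2] := ph_sections; have [D0 D1 D2] := D2_sections.
have [h1 h2] := al_J.
rewrite second_section; have -> : ph * (Y ^+ 2 * D ^+ 2) = V (y ^+ 2) * (ph * D ^+ 2).
  by rewrite VX -/Y; move: ph Y D => *; ring.
rewrite (secVM _ _ (isT : (1 < 3)%N)) sec1M p0 p1 p2 D0 D1 D2.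
transitivity (- 2%:R * y * (V ph * - (3%:R * (y * sec 1 J)) - 2%:R * q * G * - (3%:R * (y * sec 2 J)))).
  by move: (V ph) (sec 1 J) (sec 2 J) G => *; ring.
rewrite -h1 -h2; move: (V ph) al Y G => p a X g.
transitivity (3%:R * (y * X * a * (p * a + q * (g * X))) + 9%:R * (y * q * g * a * X ^+ 2 - y * p * a ^+ 2 * X)); first by ring.
by rewrite nine0 mul0r addr0.
Qed.

(** Multiplying by G turns the third section, modulo 3, into y times a series in
    q^3; and y has no section 2. *)
Lemma sec2_third_section : sec 2 (sec 1 (sec 2 (sec 1 F)) * G) = 0.
Proof.
pose w := y * Y * al * (V ph * al + q * (G * Y)) * G.
suff E : 3%:R * (V (f ^+ 3 * S (S f) ^+ 2) * w) = 3%:R * (V (S f ^+ 10) * y).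
  have c0 : cf (f ^+ 3 * S (S f) ^+ 2) 0 = 1.
    by rewrite cfM0 !cfX0 !cf_dil0 f0 !expr1n mulr1.
  rewrite third_section -mulrA -/w sec_natrM; apply: (fps_lreg c0).
  have := congr1 (sec 2) E; rewrite !sec_natrM !(secVM _ _ (isT : (2 < 3)%N)) y_sec2.
  by rewrite !mulr0 mulrCA.
have E4 : 3%:R * (S f ^+ 8) ^+ 3 = 3%:R * (f ^+ 8 * S (S f) ^+ 8 * (f ^+ 8 + q * S (S f) ^+ 8)).
  have f80 : cf (f ^+ 8) 0 = 1 by rewrite cfX0 f0 expr1n.
  by have := quartic_mod3 f80 euler_cubic; rewrite !SX.
have W : 3%:R * w = 3%:R * (y * y ^+ 3 * al * (ph ^+ 3 * al + q * (G * y ^+ 3)) * G).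
  have E := mod3D (mod3M (mod3_V ph) (erefl (3%:R * al)))
     (mod3M (erefl (3%:R * q)) (mod3M (erefl (3%:R * G)) (mod3_V y))).
  have E' := mod3M (mod3M (erefl (3%:R * y)) (mod3_V y)) (erefl (3%:R * al)).
  exact: mod3M (mod3M E' E) (erefl _).
rewrite (mod3M (mod3_V _) W) (mod3M (mod3_V (S f ^+ 10)) (erefl (3%:R * y))).
have g0 : cf (S f) 0 = 1 by rewrite cf_dil0.
have yf' := yf; have php := ph_prod.
have Gp := G_prod; have ap := al_prod.
have Q := mod3M (mod3M ap Gp) (mod3D (mod3M (erefl (3%:R * ph ^+ 3)) ap)
  (mod3M (erefl (3%:R * q)) (mod3M Gp (erefl (3%:R * y ^+ 3))))).
move: {w W Gp ap} (S f) (S (S f)) ph al G g0 yf' php E4 Q => g h p a G' g0 yf' php E4 Q.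
apply: (@mod3_cancel (g ^+ 6)); first by rewrite cfX0 g0 expr1n.
transitivity (y * f ^+ 9 * h ^+ 6 * y ^+ 3 * (3%:R * (a * g ^+ 2 * (G' * g ^+ 2) *
    (p ^+ 3 * (a * g ^+ 2) + q * (G' * g ^+ 2 * y ^+ 3))))); first by ring.
rewrite Q; transitivity (3%:R * (y * f ^+ 8 * h ^+ 8 * (y * f) ^+ 3 *
    ((p * h) ^+ 3 * f ^+ 8 + q * h ^+ 8 * (y * f) ^+ 3))); first by ring.
rewrite yf' php; transitivity (y * g ^+ 12 * (3%:R * (f ^+ 8 * h ^+ 8 * (f ^+ 8 + q * h ^+ 8)))); first by ring.
by rewrite -E4; ring.
Qed.
End Log.

Lemma sections_mod9 F : F * (S f ^+ 2 * S (S f)) = f ^+ 2 ->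
  (exists h, sec 1 (sec 2 (sec 1 F)) = 3%:R * h) /\
  sec 2 (sec 1 (sec 2 (sec 1 F)) * S ga) = 0.
Proof.
move=> F_prod; have [L [fL L0 L1 L2]] := cube_quotient_f.
split; last exact: (sec2_third_section fL L0 L1 L2 F_prod).
by have -> := third_section fL L0 L1 L2 F_prod; eexists.
Qed.
End Core.

(** * The sections of the generating function of B *)

Local Notation psi := (sparse tri (fun=> 1) : R).

Lemma cf_psi0 : cf psi 0 = 1. Proof. by rewrite /= big_ord1. Qed.
Lemma cf_theta_sq0 : cf (theta_sq Z9) 0 = 1. Proof. by rewrite /= big_ord1. Qed.

Lemma psi_sec1 : sec 1 psi = V psi.
Proof. by rewrite sec1_sparse_tri. Qed.

Lemma euler_cube_sec1 : sec 1 (f ^+ 3) = - (3%:R * V f ^+ 3).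
Proof.
rewrite -VX jacobi sec1_sparse_tri -V_natr -VM -dilN; congr dil.
apply/fpsP => n; rewrite cfN cf_natrM /= mulr_sumr -sumrN; apply: eq_bigr => m _.
case: eqP => _; last by rewrite !mulr0n mulr0 oppr0.
rewrite !mulr1n.
rewrite [(-1) ^+ (3 * m + 1)]exprD sign3 expr1.
have -> : (2 * (3 * m + 1) + 1 = 3 * (2 * m + 1))%N by lia.
by rewrite natrM; ring.
Qed.

(** Up to sign, the coefficients are the B(27m + 16), as 16 = 1 + 3 (2 + 3 * 1). *)
Definition B27 : R := sec 1 (sec 2 (sec 1 (alt (Bseries Z9)))).

Lemma B27_sections : (exists h, B27 = 3%:R * h) /\ sec 2 (B27 * S (gamma Z9)) = 0.
Proof.
have [t0 t1 t2] := theta_sq_dissection Z9.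
have f2 : sec 2 (f ^+ 3) = 0 by rewrite jacobi sec2_sparse_tri.
exact: (sections_mod9 (cf_euler0 Z9) cf_psi0 cf_theta_sq0 sec0_cube_euler
  euler_cube_sec1 f2 (psi_prod two_lreg) psi_sec1 (sec2_sparse_tri _)
  (theta_sq_prod Z9) t0 t1 t2 (alt_Bseries_prod Z9)).
Qed.

Lemma cf_B27 m : cf B27 m = (-1) ^+ m * (B (27 * m + 16))%:R.
Proof.
rewrite /B27 !cf_sec.
have -> : (3 * (3 * (3 * m + 1) + 2) + 1 = 27 * m + 16)%N by lia.
rewrite [LHS]/=; congr (_ * _).
by rewrite -signr_odd oddD oddM /= addbF signr_odd.
Qed.

(** * The alternating sum over the integers *)

Definition expo_pos j := (3 * j ^ 2 + 2 * j)%N.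
Definition expo_neg j := (3 * j ^ 2 + 4 * j + 1)%N.

Lemma gamma_eqm N M : (N <= M)%N -> eqm N (gamma Z9)
  (\sum_(j < M) ((-1) ^+ j * q ^+ expo_pos j - (-1) ^+ j * q ^+ expo_neg j)).
Proof.
move=> NM; rewrite sumrB; apply: eqmD; last apply: eqmN.
- apply: (@sparse_eqm _ _ _ (fun j => (-1) ^+ j * q ^+ expo_pos j)) => // [j|j n].
    by rewrite /expo_pos; lia.
  by rewrite cf_signXn.
- apply: (@sparse_eqm _ _ _ (fun j => (-1) ^+ j * q ^+ expo_neg j)) => // [j|j n].
    by rewrite /expo_neg; lia.
  by rewrite cf_signXn.
Qed.

Lemma cf_mul_gamma (x : R) N M : (N < M)%N ->
  cf (x * S (gamma Z9)) N = \sum_(j < M) (-1) ^+ j *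
    ((if (2 * expo_pos j <= N)%N then cf x (N - 2 * expo_pos j) else 0) -
     (if (2 * expo_neg j <= N)%N then cf x (N - 2 * expo_neg j) else 0)).
Proof.
move=> NM.
have E : eqm N.+1 (x * S (gamma Z9)) (x * \sum_(j < M) ((-1) ^+ j *
    (q ^+ (2 * expo_pos j) - q ^+ (2 * expo_neg j)))).
  apply: eqmM => //; apply: eqm_trans (eqm_dil _ (gamma_eqm NM)) _ => //.
  rewrite (big_morph S (@dilD _ 2) (@dil0 _ 2)).
  suff -> : \sum_(j < M) S ((-1) ^+ j * q ^+ expo_pos j - (-1) ^+ j * q ^+ expo_neg j) =
    \sum_(j < M) ((-1) ^+ j * (q ^+ (2 * expo_pos j) - q ^+ (2 * expo_neg j))) :> R by [].
  apply: eq_bigr => j _; rewrite dilB !SM !SX Sq -!exprM SN (dil1 _ (isT : (0 < 2)%N)).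
  by rewrite mulrBr.
rewrite (E N (ltnSn N)) mulr_sumr cf_sum; apply: eq_bigr => j _.
rewrite mulrCA mulrBr.
have sg (y : R) : cf ((-1) ^+ j * y) N = (-1) ^+ j * cf y N.
  elim: (nat_of_ord j) => [|k IHk]; first by rewrite !mul1r.
  by rewrite !exprS -!mulrA !mulN1r cfN IHk.
by rewrite sg cfB ![x * _]mulrC !cf_Xnmul.
Qed.

Lemma Z9_int (x : int) : x%:~R = 0 :> Z9 -> (x = 0 %[mod 9])%Z.
Proof.
have n9 : 9%:~R = 0 :> Z9 by exact/eqP.
rewrite {1}(divz_eq x 9) intrD intrM n9 mulr0 add0r mod0z.
have := ltz_pmod x (isT : 0 < 9 :> int); have := modz_ge0 x (isT : 9 != 0 :> int).
case: (x %% 9)%Z => // m _ m9 /(congr1 val).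
by rewrite [LHS]val_Zp_nat // modn_small // => ->.
Qed.

Lemma sum_symmetric_ints (U : nmodType) (G : int -> U) M :
    (forall k, G k != 0 -> (- M%:Z <= k < M%:Z)%R) ->
  \sum_(k \in [set: int]) G k = \sum_(j < M) (G j%:Z + G (- (j.+1)%:Z)).
Proof.
move=> supp; pose r := [seq j%:Z | j <- iota 0 M] ++ [seq - (j.+1)%:Z | j <- iota 0 M].
have Ur : uniq r.
  rewrite cat_uniq !map_inj_uniq ?iota_uniq ?andbT /=; try by move=> ? ? ; lia.
  by apply/hasPn => _ /mapP[j _ ->]; apply/negP => /mapP[i _]; lia.
rewrite -(fsbig_widen [set` r] setT); last 2 first.
- by [].
- move=> k [_ /= k_r]; apply/eqP; apply: contraT => /supp k_bounds; exfalso; apply: k_r.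
  rewrite /= mem_cat; case: k k_bounds => m /= bounds.
    by rewrite (map_f (fun j => j%:Z)) // mem_iota; lia.
  apply/orP; right; apply/mapP; exists m; last by rewrite NegzE.
  by rewrite mem_iota; lia.
rewrite -fsbig_seq // big_cat !big_map.
rewrite -(big_mkord xpredT (fun j => G j%:Z + G (- (j.+1)%:Z))) big_split.
by rewrite /index_iota subn0.
Qed.

Theorem theorem1p6 (n : nat) :
  (\sum_(k \in [set: int]) (-1) ^ k * (3 * k + 1) *
     (Bz (81 * n%:Z + 70 - 54 * k * (3 * k + 2)))%:Z = 0 %[mod 9])%Z.
Proof.
(* 81n + 70 = 27 (3n + 2) + 16, and 54 (3k^2 + 2k) = 27 * 2 (3k^2 + 2k). *)
pose N := (3 * n + 2)%N.
pose c e : Z9 := if (2 * e <= N)%N then cf B27 (N - 2 * e) else 0.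
have [[h B27h] B27_0] := B27_sections.
have BzE e : (Bz (81 * n%:Z + 70 - 54 * e%:Z))%:Z%:~R = (-1) ^+ N * c e.
  rewrite -pmulrn /c; case: leqP => [le_eN|lt_Ne].
    rewrite cf_B27.
    have -> : (81 * n%:Z + 70 - 54 * e%:Z) = (27 * (N - 2 * e) + 16)%N by rewrite /N; lia.
    rewrite /= mulrA -exprD.
    have -> : (N + (N - 2 * e) = 2 * (N - e))%N by lia.
    by rewrite exprM sqrrN !expr1n mul1r.
  rewrite mulr0; case def_m: (_ - _) => [m|//]; exfalso.
  by rewrite /N in lt_Ne; lia.
(* As B27 is divisible by 3, the factor 3k + 1 acts as 1. *)
have c3 e : 3%:R * c e = 0.
  rewrite /c; case: ifP => _; last by rewrite mulr0.
  rewrite -cf_natrM B27h.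
  have -> : 3%:R * (3%:R * h) = 9%:R * h by ring.
  by rewrite nine0 mul0r.
have signE j : ((-1) ^+ j : int)%:~R = (-1) ^+ j :> Z9 by rewrite rmorphXn rmorphN1.
have term_pos j : ((-1) ^ j%:Z * (3 * j%:Z + 1) *
    (Bz (81 * n%:Z + 70 - 54 * j%:Z * (3 * j%:Z + 2)))%:Z)%:~R
    = (-1) ^+ N * ((-1) ^+ j * c (expo_pos j)).
  have -> : 54 * j%:Z * (3 * j%:Z + 2) = 54 * (expo_pos j)%:Z by rewrite /expo_pos; lia.
  rewrite intrM BzE -exprnP intrM signE intrD intrM.
  transitivity ((-1) ^+ N * ((-1) ^+ j * c (expo_pos j)) +
     (-1) ^+ j * j%:~R * (-1) ^+ N * (3%:R * c (expo_pos j))); first by ring.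
  by rewrite c3 mulr0 addr0.
have term_neg j : ((-1) ^ (- j.+1%:Z) * (3 * - j.+1%:Z + 1) *
    (Bz (81 * n%:Z + 70 - 54 * - j.+1%:Z * (3 * - j.+1%:Z + 2)))%:Z)%:~R
    = - ((-1) ^+ N * ((-1) ^+ j * c (expo_neg j))) :> Z9.
  have -> : 54 * - j.+1%:Z * (3 * - j.+1%:Z + 2) = 54 * (expo_neg j)%:Z by rewrite /expo_neg; lia.
  have -> : (-1) ^ (- j.+1%:Z) = - (-1) ^+ j :> int.
    by rewrite -NegzE /exprz invr_sign exprS mulN1r.
  rewrite intrM BzE intrM intrN signE intrD intrM intrN.
  transitivity (- ((-1) ^+ N * ((-1) ^+ j * c (expo_neg j))) +
     (-1) ^+ j * j.+1%:~R * (-1) ^+ N * (3%:R * c (expo_neg j))); first by ring.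
  by rewrite c3 mulr0 addr0.
apply: Z9_int; rewrite (@sum_symmetric_ints _ _ N.+1); last first.
  move=> k Gk; have : Bz (81 * n%:Z + 70 - 54 * k * (3 * k + 2)) != 0%N.
    by apply: contraNneq Gk => ->; rewrite mulr0.
  case def_m: (_ - _) => [m|//] _; have : 0 <= m%:Z by [].
  by rewrite -def_m /N; nia.
rewrite rmorph_sum; transitivity ((-1) ^+ N * cf (B27 * S (gamma Z9)) N); last first.
  have := congr1 (fun x => cf x n) B27_0; rewrite cf_sec => ->.
  by rewrite cf0 mulr0.
rewrite (@cf_mul_gamma _ _ N.+1) // mulr_sumr; apply: eq_bigr => j _.
rewrite [LHS]intrD term_pos term_neg.
by rewrite -mulrBr -mulrBr.
Qed.
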